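(* The following are equivalent: (1) $(\aleph_2,\aleph_1)\twoheadrightarrow(\aleph_1,\aleph_0)$ fails; (2) There exists a coloring $c:[\omega_2]^3\rightarrow\omega_1$ with the property that for all disjoint $A,B\subseteq\omega_2$ of order-type $\omega_1$ such that $\sup(A)=\sup(B)$, for every color $\tau<\omega_1$, there is $(\alpha,\beta,\gamma)\in[A\cup B]^3\setminus([A]^3\cup[B]^3)$ such that $c(\alpha,\beta,\gamma)=\tau$.
   Context: For a set of ordinals $A$, $[A]^3$ is the set of 3-element subsets of $A$, identified with strictly increasing triples $(\alpha,\beta,\gamma)$ (i.e. $\alpha<\beta<\gamma$) of elements of $A$. $(\aleph_2,\aleph_1)\twoheadrightarrow(\aleph_1,\aleph_0)$ is Chang's conjecture: every structure $\mathfrak A$ in a countable first-order language with a distinguished unary predicate $U$, with universe of size $\aleph_2$ and $|U^{\mathfrak A}|=\aleph_1$, has an elementary substructure $\mathfrak B$ with universe of size $\aleph_1$ and $|U^{\mathfrak B}|=\aleph_0$. *)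

(* Defs.v *)
From HB Require Import structures.
From mathcomp Require Import all_boot all_order.
From mathcomp Require Import boolp classical_sets cardinality wochoice.

Set Implicit Arguments.
Unset Strict Implicit.
Unset Printing Implicit Defensive.

Local Open Scope classical_set_scope.
Local Open Scope card_scope.

(* First-order logic with equality; constants are 0-ary function symbols.     *)

Record language := Language {
  fsym : Type;
  farity : fsym -> nat;
  rsym : Type;
  rarity : rsym -> nat }.

Definition countable_language (L : language) :=
  countable [set: fsym L] /\ countable [set: rsym L].

Inductive term (L : language) : Type :=
| Var of nat
| App (f : fsym L) of ('I_(farity f) -> term L).

Inductive formula (L : language) : Type :=
| Falsum
| Equal of term L & term L
| Rel (r : rsym L) of ('I_(rarity r) -> term L)
| Imp of formula L & formula L
| Forall of nat & formula L.

Record structure (L : language) := Structure {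
  carrier :> Type;
  finterp (f : fsym L) : ('I_(farity f) -> carrier) -> carrier;
  rinterp (r : rsym L) : ('I_(rarity r) -> carrier) -> Prop }.

Section Semantics.
Context (L : language) (M : structure L).

Fixpoint eval (v : nat -> M) (t : term L) : M :=
  match t with
  | Var n => v n
  | App f a => finterp (fun i => eval v (a i))
  end.

Definition update (v : nat -> M) (n : nat) (x : M) : nat -> M :=
  fun k => if k == n then x else v k.

Fixpoint sat (v : nat -> M) (p : formula L) : Prop :=
  match p with
  | Falsum => False
  | Equal s t => eval v s = eval v t
  | Rel r a => rinterp (fun i => eval v (a i))
  | Imp p q => sat v p -> sat v q
  | Forall n p => forall x : M, sat (update v n x) p
  end.

(* The interpretation of a symbol U; meant for [rarity U = 1].                *)
Definition upred (U : rsym L) : set M := [set x | rinterp (fun _ : 'I_(rarity U) => x)].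

Definition closed_under_functions (B : set M) :=
  forall (f : fsym L) (a : 'I_(farity f) -> M),
    (forall i, B (a i)) -> B (finterp a).

Definition substructure (B : set M) (clB : closed_under_functions B) :
    structure L :=
  {| carrier := {x : M | x \in B};
     finterp f a := exist _ (finterp (fun i => sval (a i)))
       (mem_set (clB f _ (fun i => set_mem (svalP (a i)))));
     rinterp r a := rinterp (fun i => sval (a i)) |}.

End Semantics.

Arguments upred {L} M U.

Definition elementary (L : language) (M : structure L) (B : set M)
    (clB : closed_under_functions B) :=
  forall (p : formula L) (v : nat -> substructure clB),
    sat v p <-> sat (fun n => sval (v n) : M) p.

(* (|K|, |L|) ->> (|K'|, |L'|), each cardinal being given by a type of that
   cardinality.                                                               *)
Definition chang_transfer (K L K' L' : Type) :=
  forall (S : language) (U : rsym S), countable_language S -> rarity U = 1 ->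
  forall M : structure S, [set: M] #= [set: K] -> upred M U #= [set: L] ->
  exists (B : set M) (clB : closed_under_functions B),
    [/\ elementary clB, [set: substructure clB] #= [set: K'] &
        upred (substructure clB) U #= [set: L']].

(* W has the order type of the least ordinal that does not inject into K, the
   initial ordinal of cardinality |K|^+: omega_1 for K = nat, and omega_2 for K
   of order type omega_1. Ordinals are handled up to order isomorphism.       *)
Definition succ_initial_ordinal (K : Type) (d : Order.disp_t) (W : orderType d) :=
  [/\ well_order (<=%O : rel W), ~~ ([set: W] #<= [set: K]) &
      forall x : W, [set y | (y < x)%O] #<= [set: K]].

Definition has_order_type d (W : orderType d) d' (V : orderType d') (A : set V) :=
  exists2 f : W -> V, {homo f : x y / (x < y)%O} & range f = A.

Definition triples d (W : orderType d) (A : set W) : set (W * W * W) :=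
  [set t : W * W * W |
    [/\ A t.1.1, A t.1.2, A t.2, (t.1.1 < t.1.2)%O & (t.1.2 < t.2)%O]].

(* Main.v *)
Require Import Defs.
From mathcomp Require Import all_boot all_order.
From mathcomp Require Import boolp classical_sets functions cardinality wochoice.

(** Why the theorem holds.

    If Chang's conjecture is true, no coloring [c] has the property. Make [c] a
    function of a structure on omega_2 by identifying the colors with the
    elements of the distinguished subset. A substructure as in the conjecture is
    closed under [c] and so takes only countably many colors on its own triples,
    while its first omega_1 elements split into two sets A and B with the same
    supremum (chang_transfer_omits_color).

    If it fails, let a structure on omega_2 with Skolem functions witness this.
    Write [D x g] for the countable elementary substructure generated by [g] and
    the first [x] elements of the distinguished subset, and for [a < g] let
    [rho a g] be a countable ordinal [x] such that [D x g] contains [a] and has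
    no further elements of the distinguished subset. Were [rho] bounded on
    enough pairs from an uncountable set, that set would generate a substructure
    of the forbidden kind. This gives a function from pairs to omega_1 with a
    strong property of unboundedness
    (not_chang_transfer_unbounded_function), which is all that is kept of the
    failure of the conjecture.

    From [rho] to a coloring of triples there are two ways, according to the
    number of reals. If omega_2 embeds into the reals, three elements give three
    reals, and the level at which the two closest of them split is an integer
    that can be made arbitrarily large on any uncountable set. With it, a point
    of a club of omega_1 determined by A and B is read off two values of [rho]
    (many_reals_coloring); all colors are obtained because omega_1 is a union of
    omega_1 disjoint stationary sets (omega1_stationary_coloring). Otherwise
    there are only aleph_1 reals, hence only aleph_1 countable subsets of any
    ordinal below omega_2, and the values [c _ y z] can be chosen to take many
    colors on many countable sets; what has to be shown is that [rho] and the
    codes of countable sets grow fast enough for some infinite subset of A to be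
    among the sets provided for (few_reals_coloring). *)

Set Implicit Arguments.
Unset Strict Implicit.
Unset Printing Implicit Defensive.

Import Order.TTheory.

Local Open Scope classical_set_scope.
Local Open Scope card_scope.
Local Open Scope order_scope.

(** * Countable sets *)

Lemma card_le_inj (T U : Type) (u0 : U) (A : set T) (B : set U) :
  A #<= B <->
  exists2 f : T -> U, (forall x, A x -> B (f x)) & {in A &, injective f}.
Proof.
elim/Ppointed: U u0 B => U u0 B; first exact: (any u0).
by split=> [/pcard_leP/injfunPex|/injfunPex/pcard_leP].
Qed.

Lemma inj_card_leT (T U : Type) (f : T -> U) :
  injective f -> [set: T] #<= [set: U].
Proof.
move=> finj; apply: (@card_le_trans _ _ _ (range f)); last exact: card_leT.
by rewrite (card_le_eqr (inj_card_eq _)) // => x y _ _; exact: finj.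
Qed.

Lemma image_countable (T U : Type) (f : T -> U) (A : set T) :
  countable A -> countable (f @` A).
Proof. by apply: sub_countable; exact: card_image_le. Qed.
Arguments image_countable [T U] f [A].

Lemma range_countable (I : countType) (T : Type) (f : I -> T) :
  countable (range f).
Proof. exact/image_countable/countableP. Qed.
Arguments range_countable [I T] f.

Lemma subset_countable (T : Type) (A B : set T) :
  A `<=` B -> countable B -> countable A.
Proof. by move=> AB; apply: sub_countable; exact: subset_card_le. Qed.

Lemma setU_countable (T : Type) (A B : set T) :
  countable A -> countable B -> countable (A `|` B)%classic.
Proof.
move=> Ac Bc; apply: (@subset_countable _ _
  (\bigcup_(b in [set: bool]) if b then A else B)).
  by move=> x [Ax|Bx]; [exists true|exists false].
by apply: bigcup_countable => // -[].
Qed.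

Lemma not_countable_setD (T : Type) (A B : set T) :
  ~ countable A -> countable B -> ~ countable (A `\` B).
Proof.
move=> An Bc ABc; apply: An; apply: subset_countable (setU_countable ABc Bc).
by move=> x Ax; have [Bx|nBx] := pselect (B x); [right|left].
Qed.

Lemma countable_enumeration (T : Type) (Z : set T) :
  countable Z -> Z !=set0 -> exists f : nat -> T, range f = Z.
Proof.
move=> /countable_injP[e einj] [z0 Zz0].
have /choice[f fP] : forall n, exists z, Z z /\ forall x, Z x -> e x = n -> z = x.
  move=> n; have [[z [Zz zn]]|nz] := pselect (exists z, Z z /\ e z = n).
    by exists z; split=> // x Zx xn; apply: einj; rewrite ?inE // zn xn.
  by exists z0; split=> // x Zx xn; case: nz; exists x.
exists f; apply/seteqP; split=> [_ [n _ <-]|x Zx]; first by case: (fP n).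
by exists (e x) => //; case: (fP (e x)) => _; exact.
Qed.

Lemma reals_uncountable : ~ countable [set: nat -> bool].
Proof.
move=> /countable_injP[f finj].
have {}finj : injective f by move=> x y; apply: finj; rewrite inE.
pose g n := `[< exists2 x, f x = n & ~ x n >].
have [gg|/negP gg] := boolP (g (f g)).
  by have /asboolP[x /finj ->] := gg; rewrite gg.
by apply: (gg); apply/asboolP; exists g.
Qed.

(** * Well-orders and transfinite recursion *)

Section WellOrder.
Context (d : Order.disp_t) (W : orderType d).
Hypothesis wo : well_order (<=%O : rel W).

Lemma wo_least (P : set W) : P !=set0 ->
  exists2 m, P m & forall x, P x -> m <= x.
Proof.
move=> [x Px]; have [|m [[mP mle] _]] := wo (A := mem P).
  by exists x; rewrite inE.
exists m; first by rewrite inE in mP.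
by move=> y Py; apply: mle; rewrite inE.
Qed.

Lemma lt_well_founded : well_founded (fun x y : W => x < y).
Proof.
move=> x; apply: contrapT => nx.
have [m nm mle] := wo_least (P := [set y | ~ Acc (fun x y : W => x < y) y])
  (ex_intro _ x nx).
apply: nm; constructor => y ym; apply: contrapT => /mle.
by rewrite leNgt ym.
Qed.

(** The value chosen at [x] may depend on the set of the earlier values only,
    which is all that the constructions below need. *)
Lemma transfinite_choice (T : Type) (t0 : T) (Q : W -> set T -> T -> Prop) :
  (forall x (f : W -> T), exists t, Q x (f @` [set y | y < x]) t) ->
  exists f : W -> T, forall x, Q x (f @` [set y | y < x]) (f x).
Proof.
move=> QE.
have [g gP] := choice (fun xf : W * (W -> T) => QE xf.1 xf.2).
pose step x (rec : forall y, y < x -> T) :=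
  g (x, fun y => if pselect (y < x) is left yx then rec y yx else t0).
pose f := Fix lt_well_founded (fun=> T) step.
exists f => x; pose f' y := if y < x then f y else t0.
have -> : f x = g (x, f').
  rewrite /f Fix_eq.
    congr (g (x, _)); apply/funext => y; rewrite /f'.
    by case: pselect => [->//|/negP/negbTE->].
  move=> z rec rec' recE; congr (g (z, _)); apply/funext => y.
  by case: pselect.
suff -> : f @` [set y | y < x] = f' @` [set y | y < x] by exact: gP (x, f').
by apply: eq_imagel => y yx; rewrite /f' yx.
Qed.

End WellOrder.

(** * The first uncountable ordinal *)

Section Omega1.
Context (d : Order.disp_t) (W1 : orderType d).
Hypothesis om1 : succ_initial_ordinal nat W1.
Implicit Types (x y z i : W1) (S : set W1).

Let wo1 : well_order (<=%O : rel W1). Proof. by case: om1. Qed.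

Lemma omega1_lt_countable x : countable [set y | y < x].
Proof. by case: om1 => _ _; exact. Qed.

Lemma omega1_le_countable x : countable [set y | y <= x].
Proof.
apply: subset_countable (setU_countable (countable1 x) (omega1_lt_countable x)).
by move=> y /=; rewrite le_eqVlt => /orP[/eqP->|yx]; [left|right].
Qed.

Lemma omega1_uncountable : ~ countable [set: W1].
Proof. by case: om1 => _ /negP. Qed.

Lemma omega1_inhabited : exists x : W1, True.
Proof.
apply: contrapT => /forallNP W1e; apply: omega1_uncountable.
by apply: (@subset_countable _ _ set0) => // x; case: (W1e x).
Qed.

Lemma omega1_bounded S : countable S -> exists z, forall x, S x -> x < z.
Proof.
move=> Sc; apply: contrapT => /forallNP Sub; apply: omega1_uncountable.
apply: (@subset_countable _ _ (\bigcup_(x in S) [set y | y <= x])).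
  move=> z _; have /existsNP[x /not_implyP[Sx /negP]] := Sub z.
  by rewrite -leNgt => zx; exists x.
by apply: bigcup_countable => // x _; exact: omega1_le_countable.
Qed.

Lemma omega1_unbounded_uncountable S :
  (forall x, exists2 y, S y & x < y) -> ~ countable S.
Proof.
move=> Su /omega1_bounded[z zP]; have [y /zP yz zy] := Su z.
by have := lt_trans yz zy; rewrite ltxx.
Qed.

Lemma omega1_embeds (T : Type) (A : set T) : ~ countable A ->
  exists2 f : W1 -> T, injective f & forall x, A (f x).
Proof.
move=> An.
have [t0 At0] : A !=set0.
  by apply: contrapT => /nonemptyPn A0; apply: An; rewrite A0.
have [|f fP] := transfinite_choice wo1 t0 (Q := fun _ R t => A t /\ ~ R t).
  move=> x f; apply: contrapT => H; apply: An.
  apply: subset_countable (image_countable f (omega1_lt_countable x)) => t At.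
  by apply: contrapT => ft; apply: H; exists t.
exists f => [x y fxy|x]; last by case: (fP x).
case: (ltgtP x y) => // [xy|yx].
  by case: (fP y) => _ []; exists x.
by case: (fP x) => _ []; exists y.
Qed.

Lemma omega1_sequence x : exists2 f : nat -> W1, injective f &
  exists y, forall n, x < f n < y.
Proof.
have /choice[s sP] : forall y, exists z, y < z.
  by move=> y; have [z zP] := omega1_bounded (countable1 y); exists z; exact: zP.
pose f n := iter n.+1 s x.
have fS n : f n < f n.+1 by exact: sP.
have flt m n : (m < n)%N -> f m < f n.
  elim: n => // n IHn; rewrite ltnS leq_eqVlt => /orP[/eqP->//|/IHn fmn].
  exact: lt_trans (fS n).
have [z zP] := omega1_bounded (range_countable f).
exists f.
  move=> m n fmn; case: (ltngtP m n) => // /flt; by rewrite fmn ltxx.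
exists z => n; rewrite zP ?andbT; last by exists n.
by elim: n => [|n IHn]; [exact: sP|exact: lt_trans (fS n)].
Qed.

(** The points closed under a function form a club, and every club contains
    all nonzero points closed under some function. So functions stand for clubs
    in what follows. *)
Lemma omega1_closure_point (F : W1 -> W1) x :
  exists2 y, x < y & forall z, z < y -> F z < y.
Proof.
have /choice[s sP] : forall y, exists u, y < u /\ forall z, z <= y -> F z < u.
  move=> y; have [|z zP] := omega1_bounded (S := y |` (F @` [set z | z <= y])).
    exact/setU_countable/image_countable/omega1_le_countable.
  exists z; split; first by apply: zP; left.
  by move=> u uy; apply: zP; right; exists u.
pose f n := iter n s x.
have [z zP] := omega1_bounded (range_countable f).
have [m mP mle] := wo_least wo1 (P := [set z | forall n, f n < z])
  (ex_intro _ z (fun n => zP _ (ex_intro2 _ _ n I erefl))).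
exists m; first exact: (mP 0%N).
move=> u um; have [n un] : exists n, u <= f n.
  apply: contrapT => /forallNP un.
  suff /mle : forall n, f n < u by rewrite leNgt um.
  by move=> n; rewrite ltNge; exact/negP.
by apply: lt_trans (mP n.+1); case: (sP (f n)) => _; exact.
Qed.

(** Transfinite recursion splits off disjoint countably infinite blocks of
    omega_1, one for each rank, into which the fibers are mapped. This one
    lemma takes the place of the arithmetic of aleph_1. *)
Lemma omega1_rank_card (T : Type) (A : set T) (k : T -> W1) :
  (forall i, countable [set t | A t /\ k t = i]) -> A #<= [set: W1].
Proof.
move=> kc; have [x0 _] := omega1_inhabited.
have /choice[s sP] : forall x, exists s : nat -> W1,
    injective s /\ forall n, x < s n.
  move=> x; have [f finj [y fy]] := omega1_sequence x; exists f.
  by split=> // n; case/andP: (fy n).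
have [|g gP] := transfinite_choice wo1 x0
    (Q := fun _ R t => forall y n, R y -> s y n < t).
  move=> x f.
  have [|z zP] := omega1_bounded (S := \bigcup_(y in f @` [set y | y < x]) range (s y)).
    apply: bigcup_countable => [|y _]; last exact: range_countable.
    exact/image_countable/omega1_lt_countable.
  by exists z => y n Sy; apply: zP; exists y => //; exists n.
have gs x y n : x < y -> s (g x) n < g y by move=> xy; apply: gP; exists x.
have /choice[e eP] : forall i, exists e : T -> nat,
    {in [set t | A t /\ k t = i] &, injective e}.
  by move=> i; apply/countable_injP.
apply/(card_le_inj x0); exists (fun t => s (g (k t)) (e (k t) t)) => //.
move=> t u; rewrite !inE => At Au tu.
have ktu : k t = k u.
  case: (ltgtP (k t) (k u)) => // ktu.
    have := gs _ _ (e (k t) t) ktu; rewrite tu => h.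
    by have := lt_trans ((sP (g (k u))).2 (e (k u) u)) h; rewrite ltxx.
  have := gs _ _ (e (k u) u) ktu; rewrite -tu => h.
  by have := lt_trans ((sP (g (k t))).2 (e (k t) t)) h; rewrite ltxx.
move: tu; rewrite ktu => /((sP _).1) etu.
by apply: (eP (k u)); rewrite ?inE.
Qed.

Lemma omega1_square_card : [set: W1 * W1] #<= [set: W1].
Proof.
apply: (omega1_rank_card (k := fun p => Order.max p.1 p.2)) => i.
apply: subset_countable (countableX (omega1_le_countable i) (omega1_le_countable i)).
by move=> p [_ <-] /=; rewrite !le_max !lexx orbT.
Qed.

(** A coloring of omega_1 with stationary color classes, after Ulam: fix
    enumerations of the countable ordinals and let [h x m] be the m-th element
    of [x]. As the nonstationary sets form a sigma-ideal, each [t] is the value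
    of [h _ m] on a stationary set for some [m]; so for some [m] this happens
    for uncountably many [t], which are then renamed to be all of omega_1. *)
Lemma omega1_stationary_coloring :
  exists p : W1 -> W1, forall (t : W1) (F : W1 -> W1) (x : W1),
    exists y, [/\ x < y, forall z, z < y -> F z < y & p y = t].
Proof.
have [x0 _] := omega1_inhabited.
have /choice[h hP] : forall x, exists h : nat -> W1,
    forall y, y < x -> exists n, h n = y.
  move=> x.
  have /countable_injP[e einj] := omega1_lt_countable x.
  have /choice[h hP] : forall n, exists z,
      (exists2 y, y < x & e y = n) -> z < x /\ e z = n.
    move=> n; have [[y yx <-]|] := pselect (exists2 y, y < x & e y = n).
      by exists y.
    by exists x0.
  exists h => y yx; exists (e y).
  have [|hx ehy] := hP (e y); first by exists y.
  by apply: einj; rewrite ?inE.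
pose stat m t := forall F x,
  exists y, [/\ x < y, forall z, z < y -> F z < y & h y m = t].
have statE t : exists m, stat m t.
  apply: contrapT => /forallNP nstat.
  have /choice[Fx FxP] : forall m, exists Fx : (W1 -> W1) * W1, forall y,
      Fx.2 < y -> (forall z, z < y -> Fx.1 z < y) -> h y m <> t.
    move=> m.
    have /existsNP[F /existsNP[x /forallNP Fx]] := nstat m.
    by exists (F, x) => y xy Fy hy; apply: (Fx y); split.
  have /choice[F FP] : forall z, exists u, forall m, (Fx m).1 z < u.
    move=> z; have [u uP] := omega1_bounded
      (range_countable (fun m => (Fx m).1 z)).
    by exists u => m; apply: uP; exists m.
  have [b bP] := omega1_bounded (range_countable (fun m => (Fx m).2)).
  have [y by_ Fy] := omega1_closure_point F (Order.max b t).
  move: by_; rewrite gt_max => /andP[by_ ty].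
  have [m hy] := hP y t ty.
  apply: (FxP m y) hy => [|z zy].
    by apply: lt_trans by_; apply: bP; exists m.
  exact: lt_trans (FP z m) (Fy z zy).
have [m mP] : exists m, ~ countable [set t | stat m t].
  apply: contrapT => /forallNP H; apply: omega1_uncountable.
  apply: (@subset_countable _ _ (\bigcup_m [set t | stat m t])).
    by move=> t _; have [m tm] := statE t; exists m.
  by apply: bigcup_countable => // m _; apply: contrapT; exact: H.
have [f finj fP] := omega1_embeds mP.
have [g gP] : exists g : W1 -> W1, forall t, g (f t) = t.
  have /choice[g gP] : forall u, exists v, (exists t, f t = u) -> f v = u.
    move=> u; have [[t tu]|] := pselect (exists t, f t = u); by [exists t|exists x0].
  by exists g => t; apply: finj; apply: gP; exists t.
exists (fun y => g (h y m)) => t F x.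
by have [y [xy Fy hy]] := fP t F x; exists y; split; rewrite ?hy.
Qed.

End Omega1.

(** * The second uncountable ordinal *)

Lemma inj_countable (T U : Type) (f : T -> U) (A : set U) :
  injective f -> (forall x, A (f x)) -> countable A -> countable [set: T].
Proof.
move=> finj fA Ac.
have /eq_countable <- : range f #= [set: T].
  by apply: inj_card_eq => x y _ _; exact: finj.
by apply: subset_countable Ac => _ [x _ <-].
Qed.

Section Omega2.
Context (d1 d2 : Order.disp_t) (W1 : orderType d1) (W2 : orderType d2).
Hypothesis om1 : succ_initial_ordinal nat W1.
Hypothesis om2 : succ_initial_ordinal W1 W2.

Let wo1 : well_order (<=%O : rel W1). Proof. by case: om1. Qed.
Let wo2 : well_order (<=%O : rel W2). Proof. by case: om2. Qed.

Lemma omega2_lt_card (x : W2) : [set y | y < x] #<= [set: W1].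
Proof. by case: om2 => _ _; exact. Qed.

Lemma omega2_le_card (x : W2) : [set y | y <= x] #<= [set: W1].
Proof.
have [x0 _] := omega1_inhabited om1.
have /(card_le_inj x0)[e _ einj] := omega2_lt_card x.
(* adding the last point [x] keeps the fibers of [e] countable *)
apply: (omega1_rank_card om1 (k := e)) => i.
have [[y [yx ey]]|ni] := pselect (exists y, y < x /\ e y = i); last first.
  apply: (@subset_countable _ _ [set x]); last exact: countable1.
  move=> y /= [yx ey]; apply: contrapT => /eqP nyx.
  by apply: ni; exists y; rewrite lt_neqAle nyx.
apply: (@subset_countable _ _ [set x; y]).
  move=> z /= [zx ez]; have [->|nzx] := eqVneq z x; first by left.
  right; apply: einj; rewrite ?inE /= ?ez ?ey //.
  by rewrite lt_neqAle nzx.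
exact/finite_set_countable/finite_set2.
Qed.

Lemma omega2_card : ~ ([set: W2] #<= [set: W1]).
Proof. by case: om2 => _ /negP. Qed.

Lemma omega2_bounded (f : W1 -> W2) : exists z, forall i, f i < z.
Proof.
have [x0 _] := omega1_inhabited om1.
apply: contrapT => /forallNP fub; apply: omega2_card.
apply: card_le_trans (omega1_square_card om1).
have /choice[k kP] : forall y, exists i, y <= f i.
  move=> y; have /existsNP[i /negP] := fub y; rewrite -leNgt => yi.
  by exists i.
have /choice[e eP] : forall x : W2, exists e : W2 -> W1,
    {in [set y | y <= x] &, injective e}.
  move=> x; have /(card_le_inj x0)[e _ einj] := omega2_le_card x.
  by exists e.
apply: (@inj_card_leT _ _ (fun y => (k y, e (f (k y)) y))).
move=> y z [kyz]; rewrite kyz; apply: eP; rewrite inE //=.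
by rewrite -kyz; exact: kP.
Qed.

Lemma omega2_uncountable : ~ countable [set: W2].
Proof.
move=> W2c; apply: omega2_card; apply: (card_le_trans W2c).
apply/infiniteP => /finite_set_countable.
exact: omega1_uncountable om1.
Qed.

Lemma omega1_enumerates (B : set W2) : ~ countable B ->
  exists2 f : W1 -> W2, {homo f : x y / x < y} & forall x, B (f x).
Proof.
move=> Bn; have [f0 _ f0B] := omega1_embeds om1 Bn.
have [x0 _] := omega1_inhabited om1.
have [|f fP] := transfinite_choice wo1 (f0 x0)
    (Q := fun _ R t => [/\ B t, ~ R t & forall u, B u -> ~ R u -> t <= u]).
  move=> x f; have [|m [Bm nm] mle] := wo_least wo2
      (P := B `\` (f @` [set y | y < x])).
    apply: contrapT => /nonemptyPn BD.
    have := not_countable_setD Bn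
      (image_countable f (omega1_lt_countable om1 x)).
    by rewrite BD => /(_ (countable0 _)).
  by exists m; split=> // u Bu nu; apply: mle.
exists f => [x y xy|x]; last by case: (fP x).
have [_ _ le] := fP x; have [By ny _] := fP y.
rewrite lt_neqAle; apply/andP; split.
  by apply/eqP => fxy; apply: ny; exists x.
apply: le => // -[z zx fz]; apply: ny; exists z => //.
exact: lt_trans zx xy.
Qed.

(** The coloring is made a function of a structure on omega_2. A Chang
    substructure contains all the values at its own triples, but omits some
    color; two cofinal halves of its first omega_1 elements then violate the
    property of the coloring. *)
Lemma chang_transfer_omits_color (c : triples [set: W2] -> W1) :
  chang_transfer W2 W1 W1 nat ->
  exists A B : set W2, exists tau : W1,
    [/\ A `&` B = set0, has_order_type W1 A, has_order_type W1 B,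
        exists s : W2, supremums A s /\ supremums B s &
        forall t : triples [set: W2],
          triples (A `|` B) (val t) -> c t <> tau].
Proof.
move=> chang.
have [x0 _] := omega1_inhabited om1.
have [e einj _] := omega1_embeds om1 omega2_uncountable.
have /choice[c' cP] : forall p : W2 * W2 * W2, exists x,
    forall t : triples [set: W2], val t = p -> c t = x.
  move=> p; have [[t tp]|nt] := pselect (exists t : triples [set: W2], val t = p).
    by exists (c t) => u up; congr c; apply: val_inj; rewrite up.
  by exists x0 => t tp; case: nt; exists t.
pose S := Language (fun _ : unit => 3) (fun _ : unit => 1).
pose M : structure S := @Structure S W2
  (fun _ (a : 'I_3 -> W2) => e (c' (a (inord 0), a (inord 1), a (inord 2))))
  (fun _ (a : 'I_1 -> W2) => range e (a ord0)).
have SC : countable_language S by split; exact: countableP.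
have MU : upred M tt #= [set: W1].
  by apply: inj_card_eq => x y _ _; exact: einj.
have [B [clB [_ BW1 BU]]] := chang S tt SC erefl M (card_eqxx _) MU.
have Bn : ~ countable B.
  rewrite -(eq_countable (card_setT B)) (eq_countable BW1).
  exact: omega1_uncountable om1.
have [tau tauP] : exists tau, ~ B (e tau).
  apply: contrapT => /forallNP eB.
  have eB' i : e i \in B by rewrite inE; exact: contrapT (eB i).
  apply: (omega1_uncountable om1).
  apply: (@inj_countable _ _ (fun i => exist _ (e i) (eB' i) : substructure clB)
    (upred (substructure clB) tt)).
  - by move=> i j [/einj].
  - by move=> i; exists i.
  - by rewrite (eq_countable BU).
have [f fmono fB] := omega1_enumerates Bn.
have /choice[s sP] : forall y : W1, exists z, y < z.
  move=> y; have [z zP] := omega1_bounded om1 (countable1 y).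
  by exists z; exact: zP.
have [|g gP] := transfinite_choice wo1 x0
    (Q := fun _ R t => forall y, R y -> s y < t).
  move=> x g.
  have [z zP] := omega1_bounded om1 (image_countable s
    (image_countable g (omega1_lt_countable om1 x))).
  by exists z => y Ry; apply: zP; exists y.
have sg x y : x < y -> s (g x) < g y by move=> xy; apply: gP; exists x.
have gmono x y : x < y -> g x < g y by move=> xy; exact: lt_trans (sg _ _ xy).
pose A1 := range (f \o g); pose A2 := range (f \o s \o g).
have ub12 : ubound A1 = ubound A2.
  apply/seteqP; split=> z zP _ [i _ <-] /=.
    apply/ltW; apply: lt_le_trans (zP (f (g (s i))) _); last by exists (s i).
    exact/fmono/sg.
  apply/ltW; apply: lt_le_trans (zP (f (s (g i))) _); last by exists i.
  exact/fmono.
have A12B : A1 `|` A2 `<=` B by move=> z [] [i _ <-]; exact: fB.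
exists A1, A2, tau; split.
- apply/seteqP; split=> // _ [[i _ <-] [j _ /=]].
  have finj : injective f.
    move=> x y fxy; case: (ltgtP x y) => // /fmono; by rewrite fxy ltxx.
  move=> /finj; case: (ltgtP i j) => [ij|ji|<-] E.
  + have := lt_trans (gmono _ _ ij) (sP (g j)); by rewrite E ltxx.
  + by have := sg _ _ ji; rewrite E ltxx.
  + by have := sP (g i); rewrite E ltxx.
- by exists (f \o g) => // x y xy; exact/fmono/gmono.
- exists (f \o s \o g) => // x y xy; apply/fmono.
  exact: lt_trans (sg _ _ xy) (sP _).
- have [z zP] := omega2_bounded f.
  have [m mP mle] := wo_least wo2 (P := ubound A1)
    (ex_intro _ z (fun _ '(ex_intro2 i _ E) =>
       ltW (eq_ind _ (fun u => u < z) (zP _) _ E))).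
  by exists m; rewrite /supremums -ub12; split; split.
- move=> t [/A12B Ba /A12B Bb /A12B Bc _ _] ct; apply: tauP.
  have <- : c' (val t) = tau by rewrite -(cP _ t erefl).
  have [a aE] : exists a : 'I_3 -> W2, [/\ a (inord 0) = (val t).1.1,
      a (inord 1) = (val t).1.2 & a (inord 2) = (val t).2].
    exists (fun i : 'I_3 => if i == 0%N :> nat then (val t).1.1
      else if i == 1%N :> nat then (val t).1.2 else (val t).2).
    by rewrite !inordK.
  have aB i : B (a i).
    case: aE => a0 a1 a2; case: i => -[|[|[|//]]] i3.
    + by rewrite (_ : Ordinal i3 = inord 0) ?a0 //; apply: val_inj; rewrite /= inordK.
    + by rewrite (_ : Ordinal i3 = inord 1) ?a1 //; apply: val_inj; rewrite /= inordK.
    + by rewrite (_ : Ordinal i3 = inord 2) ?a2 //; apply: val_inj; rewrite /= inordK.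
  have := clB tt a aB; rewrite /=; case: aE => -> -> ->.
  by rewrite -!surjective_pairing.
Qed.

End Omega2.

(** * Skolem functions *)

Section Skolem.
Context (L : language).

Lemma term_countable :
  countable [set: Defs.fsym L] -> countable [set: term L].
Proof.
move=> /countable_injP[cf cfinj].
(* terms and formulas are coded by finite trees labelled by integers *)
pose code := fix code (t : term L) : GenTree.tree nat :=
  match t with
  | Var n => GenTree.Leaf n
  | App f a => GenTree.Node (cf f) [seq code (a i) | i <- enum 'I_(farity f)]
  end.
apply/countable_injP; exists (pickle \o code) => s t _ _.
move=> /(pcan_inj pickleK); elim: s t => [n|f a IH] [m|g b] //= => [[->]//|].
case=> /cfinj fg; have {}fg : f = g by apply: fg; rewrite inE.
subst g => ab; congr App; apply/funext => i; apply: IH.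
by move/eq_in_map : ab => /(_ i); apply; rewrite mem_enum.
Qed.

Lemma formula_countable :
  countable_language L -> countable [set: formula L].
Proof.
move=> [/term_countable/countable_injP[ct ctinj] /countable_injP[cr crinj]].
have {}ctinj : injective ct by move=> s t; apply: ctinj; rewrite inE.
pose code := fix code (p : formula L) : GenTree.tree nat :=
  match p with
  | Falsum => GenTree.Leaf 0
  | Equal s t => GenTree.Node 0 [:: GenTree.Leaf (ct s); GenTree.Leaf (ct t)]
  | Rel r a => GenTree.Node (cr r).+1
      [seq GenTree.Leaf (ct (a i)) | i <- enum 'I_(rarity r)]
  | Imp p q => GenTree.Node 0 [:: GenTree.Node 0 [:: code p]; code q]
  | Forall n p => GenTree.Node 0 [:: GenTree.Leaf n; GenTree.Node 0 [:: code p]]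
  end.
apply/countable_injP; exists (pickle \o code) => p q _ _.
move=> /(pcan_inj pickleK).
elim: p q => [|s t|r a|p IHp q IHq|n p IHp] [|s' t'|r' a'|p' q'|n' p'] //=.
- by case=> /ctinj-> /ctinj->.
- case=> /crinj rr; have {}rr : r = r' by apply: rr; rewrite inE.
  subst r' => aa; congr Rel; apply/funext => i; apply: ctinj.
  by move/eq_in_map/(_ i) : aa; rewrite mem_enum => /(_ isT)[].
- by case=> /IHp-> /IHq->.
- by case=> -> /IHp->.
Qed.

Section Semantics.
Context (M : structure L).

Lemma eval_finite_support (t : term L) : exists N, forall v w : nat -> M,
  (forall k, (k < N)%N -> v k = w k) -> eval v t = eval w t.
Proof.
elim: t => [n|f a /choice[N NP]].
  by exists n.+1 => v w; apply.
exists (\max_i N i) => v w vw /=; congr finterp; apply/funext => i.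
by apply: NP => k kN; apply/vw/(leq_trans kN)/leq_bigmax.
Qed.

Lemma sat_finite_support (p : formula L) : exists N, forall v w : nat -> M,
  (forall k, (k < N)%N -> v k = w k) -> sat v p <-> sat w p.
Proof.
elim: p => [|s t|r a|p [N NP] q [N' NP']|n p [N NP]].
- by exists 0%N.
- have [N NP] := eval_finite_support s; have [N' NP'] := eval_finite_support t.
  exists (maxn N N') => v w vw /=.
  rewrite (NP v w) ?(NP' v w) // => k kN; apply/vw; rewrite leq_max kN ?orbT //.
- have /choice[N NP] := fun i => eval_finite_support (a i).
  exists (\max_i N i) => v w vw /=.
  suff -> : (fun i => eval v (a i)) = (fun i => eval w (a i)) by [].
  by apply/funext => i; apply: NP => k kN; apply/vw/(leq_trans kN)/leq_bigmax.
- exists (maxn N N') => v w vw /=.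
  have pE : sat v p <-> sat w p.
    by apply: NP => k kN; apply/vw; rewrite leq_max kN.
  have qE : sat v q <-> sat w q.
    by apply: NP' => k kN; apply/vw; rewrite leq_max kN orbT.
  by split=> h /pE/h/qE.
- exists N => v w vw /=.
  have E x : sat (update v n x) p <-> sat (update w n x) p.
    by apply: NP => k kN; rewrite /update; case: eqP => // _; exact: vw.
  by split=> h x; apply/E.
Qed.

(** The Tarski-Vaught test: a counterexample to a formula is chosen as a
    function of the values of finitely many variables, those on which the
    formula depends. The functions of the language are among the [G k], which
    act on finite sequences to make them all of one type. *)
Lemma skolem_functions (m0 : M) : countable_language L ->
  exists I : Type, exists2 G : I -> seq M -> M, countable [set: I] &
  forall B : set M,
    (forall k s, (forall i, (i < size s)%N -> B (nth m0 s i)) -> B (G k s)) ->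
  exists clB : closed_under_functions B, elementary clB.
Proof.
move=> Lc.
have /choice[w wP] : forall x : nat * formula L * seq M, exists y : M,
    (exists z, ~ sat (update (nth m0 x.2) x.1.1 z) x.1.2) ->
    ~ sat (update (nth m0 x.2) x.1.1 y) x.1.2.
  move=> x; have [[y yP]|] := pselect (exists z, ~ sat (update (nth m0 x.2) x.1.1 z) x.1.2).
    by exists y.
  by exists m0.
exists (Defs.fsym L + (nat * formula L))%type.
exists (fun k s => match k with
  | inl f => finterp (fun i : 'I_(farity f) => nth m0 s i)
  | inr q => w (q, s)
  end).
  have /countable_injP[cf cfinj] := Lc.1.
  have /countable_injP[cp cpinj] := formula_countable Lc.
  apply/countable_injP; exists (fun k => pickle (match k with
    | inl f => inl (cf f) | inr (n, p) => inr (n, cp p) end : nat + nat * nat)).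
  move=> [f|[n p]] [g|[m q]] _ _ /(pcan_inj pickleK) // [].
    by move=> /cfinj ->; rewrite ?inE.
  by move=> -> /cpinj ->; rewrite ?inE.
move=> B BG.
have clB : closed_under_functions B.
  move=> f a aB; have aE : a = fun i : 'I_(farity f) => nth m0 [seq a i | i <- enum 'I_(farity f)] i.
    by apply/funext => i; rewrite (nth_map i) ?size_enum_ord // nth_ord_enum.
  rewrite aE; apply: (BG (inl f)) => i; rewrite size_map size_enum_ord => ilt.
  by rewrite (nth_map (Ordinal ilt)) ?size_enum_ord.
exists clB.
have evalE (v : nat -> substructure clB) t :
    sval (eval v t) = eval (fun n => sval (v n) : M) t.
  elim: t => //= f a IH; congr finterp; exact/funext.
elim=> [|s t|r a|p IHp q IHq|n p IHp] v //=.
- by rewrite -!evalE; split=> [->//|]; exact: val_inj.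
- suff -> : (fun i => eval (fun n => sval (v n) : M) (a i)) =
      (fun i => sval (eval v (a i))) by [].
  by apply/funext => i; rewrite evalE.
- by split=> h /IHp/h/IHq.
have updE (b : substructure clB) :
    (fun k => sval (update v n b k) : M) = update (fun k => sval (v k) : M) n (sval b).
  by apply/funext => k; rewrite /update; case: eqP.
split=> h x; last by apply/IHp; rewrite updE.
apply: contrapT => nx.
have [N NP] := sat_finite_support p.
set u := fun k => sval (v k) : M; pose s := mkseq u N.
have sP y : sat (update (nth m0 s) n y) p <-> sat (update u n y) p.
  by apply: NP => k kN; rewrite /update; case: eqP => // _; rewrite nth_mkseq.
have wB : w (n, p, s) \in B.
  rewrite inE; apply: (BG (inr (n, p))) => i; rewrite size_mkseq => iN.
  by rewrite nth_mkseq // /u; have := svalP (v i); rewrite inE.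
have := h (exist _ (w (n, p, s)) wB); move/IHp; rewrite updE /= => /sP.
by apply: (wP (n, p, s)); exists x => /sP.
Qed.

End Semantics.
End Skolem.

(** * Hulls *)

Section Hull.
Context (T : eqType) (I : Type) (G : I -> seq T -> T).
Implicit Types (X Y : set T) (s : seq T).

Definition closed_under Y :=
  forall i s, (forall x, x \in s -> Y x) -> Y (G i s).

Definition hull X : set T :=
  [set t | forall Y, closed_under Y -> X `<=` Y -> Y t].

Lemma subset_hull X : X `<=` hull X.
Proof. by move=> x Xx Y _; exact. Qed.

Lemma hull_closed X : closed_under (hull X).
Proof.
by move=> i s sX Y Ycl XY; apply: (Ycl) => x /sX; exact.
Qed.

Lemma hull_min X Y : closed_under Y -> X `<=` Y -> hull X `<=` Y.
Proof. by move=> Ycl XY t; exact. Qed.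

Lemma hull_mono X Y : X `<=` Y -> hull X `<=` hull Y.
Proof.
by move=> XY; apply: hull_min (@hull_closed Y) (subset_trans XY (@subset_hull Y)).
Qed.

Lemma seq_countable X : countable X -> countable [set s : seq T | forall x, x \in s -> X x].
Proof.
move=> /countable_injP[f finj]; apply/countable_injP.
exists (fun s => pickle (map f s)) => s t; rewrite !inE => sX tX.
move=> /(pcan_inj pickleK); elim: s t sX tX => [|x s IH] [|y t] //= sX tX [xy st].
congr cons.
  by apply: finj => //; rewrite inE; [apply: sX|apply: tX]; exact: mem_head.
by apply: IH => // z zs; [apply: sX|apply: tX]; rewrite inE zs orbT.
Qed.

Lemma hull_countable X : countable [set: I] -> countable X -> countable (hull X).
Proof.
move=> Ic Xc.
pose step (Z : set T) : set T := (Z `|` \bigcup_(i in [set: I]) (G i @` [set s : seq T | forall x, x \in s -> Z x]))%classic.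
pose Z n := iter n step X.
apply: (@subset_countable _ _ (\bigcup_n Z n)); last first.
  apply: bigcup_countable => // n _; elim: n => // n IHn.
  apply: setU_countable => //; apply: bigcup_countable => // i _.
  exact/image_countable/seq_countable.
have Zle m n : (m <= n)%N -> Z m `<=` Z n.
  elim: n => [|n IHn]; first by rewrite leqn0 => /eqP->.
  by rewrite leq_eqVlt => /orP[/eqP->//|/IHn mn] t /mn tn; left.
apply: hull_min => [i s sZ|x Xx]; last by exists 0%N.
suff [n nP] : exists n, forall x, x \in s -> Z n x.
  by exists n.+1 => //; right; exists i => //; exists s.
elim: s sZ => [|x s IH] sZ; first by exists 0%N.
have [|n nP] := IH; first by move=> y ys; apply: sZ; rewrite inE ys orbT.
have [m _ mP] := sZ x (mem_head _ _).
exists (maxn m n) => y; rewrite inE => /predU1P[->|/nP yn].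
  by apply: Zle mP; exact: leq_maxl.
by apply: Zle yn; exact: leq_maxr.
Qed.

Lemma hull_finitary X t : hull X t ->
  exists2 s : seq T, (forall x, x \in s -> X x) & hull [set` s] t.
Proof.
pose Y := [set t | exists2 s : seq T, (forall x, x \in s -> X x) & hull [set` s] t].
move: t; apply: (@hull_min X Y) => [i s sX|x Xx]; last first.
  exists [:: x] => [y|]; first by rewrite inE => /eqP->.
  by apply: subset_hull; rewrite /= inE.
suff [r rX sr] : exists2 r : seq T, (forall x, x \in r -> X x) &
    forall x, x \in s -> hull [set` r] x by exists r => //; exact: hull_closed.
elim: s sX => [|x s IH] sX; first by exists [::].
have [|r rX sr] := IH; first by move=> y ys; apply: sX; rewrite inE ys orbT.
have [q qX xq] := sX x (mem_head _ _).
exists (q ++ r) => [y|y]; first by rewrite mem_cat => /orP[/qX|/rX].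
rewrite inE => /predU1P[->|ys].
  by apply: hull_mono xq => z /= zq; rewrite mem_cat zq.
by apply: hull_mono (sr y ys) => z /= zr; rewrite mem_cat zr orbT.
Qed.

End Hull.

(** * The unbounded function extracted from a failure of Chang's conjecture *)

Lemma seq_strict_bound (d : Order.disp_t) (W : orderType d) (T : eqType)
    (h : T -> W) (s : seq T) (z0 y : W) :
  z0 < y -> (forall x, x \in s -> h x < y) ->
  exists2 z, z < y & forall x, x \in s -> h x <= z.
Proof.
move=> z0y; elim: s => [|x s IH] sy; first by exists z0.
have [|z zy zP] := IH; first by move=> u us; apply: sy; rewrite inE us orbT.
exists (Order.max (h x) z); first by rewrite gt_max zy sy ?mem_head.
by move=> u; rewrite inE le_max => /predU1P[->|/zP ->]; rewrite ?lexx ?orbT.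
Qed.

Lemma seq_maximum (d : Order.disp_t) (W : orderType d) (T : eqType)
    (h : T -> W) (s : seq T) : s != [::] ->
  exists2 x, x \in s & forall y, y \in s -> h y <= h x.
Proof.
elim: s => // x [|x' s] IH _.
  by exists x => [|y]; rewrite inE // => /eqP->.
have [//|y ys yP] := IH; case: (leP (h x) (h y)) => xy.
  by exists y => [|z]; rewrite inE ?ys ?orbT // => /predU1P[->//|/yP].
exists x; first exact: mem_head.
by move=> z; rewrite inE => /predU1P[->//|/yP zy]; exact: le_trans (ltW xy).
Qed.

Lemma card_eq_set_bij (T U : Type) (u0 : U) (A : set T) (B : set U) :
  A #= B -> exists f : T -> U, set_bij A B f.
Proof.
elim/Ppointed: U u0 B => U u0 B; first exact: (any u0).
by move/card_set_bijP.
Qed.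

Section UnboundedFunction.
Context (d1 d2 : Order.disp_t) (W1 : orderType d1) (W2 : orderType d2).
Hypothesis om1 : succ_initial_ordinal nat W1.
Hypothesis om2 : succ_initial_ordinal W1 W2.

(** The second condition says more than that [rho] is unbounded on the pairs of
    an uncountable set: finitely many elements of the set already make
    [rho _ g] large, for all later [g] and not only for those in the set. This
    uniformity lets large values of [rho] be found below closure points. *)
Definition unbounded_function (rho : W2 -> W2 -> W1) :=
  (forall g x, countable [set a | a < g /\ rho a g <= x]) /\
  (forall A x, ~ countable A -> exists2 F : seq W2, (forall a, a \in F -> A a) &
     forall g, (forall a, a \in F -> a < g) -> exists2 a, a \in F & x < rho a g).

Section Algebra.
Context (I : Type) (G : I -> seq W2 -> W2) (u : W1 -> W2).
Hypothesis I_countable : countable [set: I].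
Hypothesis u_inj : injective u.
Hypothesis G_enum : forall a g, a < g -> exists i x, G i [:: g; u x] = a.

(* [u] enumerates the distinguished subset, and [D x g] is a countable algebra
   containing its first elements; [good] says that [D x g] meets the
   distinguished subset in an initial segment *)
Let D x g := hull G ([set g] `|` u @` [set y | y < x])%classic.
Let good x g := forall y, D x g (u y) -> y < x.

Let D_mono x y g : x <= y -> D x g `<=` D y g.
Proof.
move=> xy; apply: hull_mono => a [->|[z zx <-]]; [by left|right].
by exists z => //; exact: lt_le_trans xy.
Qed.

Let D_countable x g : countable (D x g).
Proof.
apply: hull_countable => //.
exact/setU_countable/image_countable/(omega1_lt_countable om1).
Qed.

Let good_exists x g : exists2 y, x < y & good y g.
Proof.
have /choice[s sP] : forall z : W1, exists y, z < y.
  by move=> z; have [y yP] := omega1_bounded om1 (countable1 z); exists y; exact: yP.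
have /choice[F FP] : forall z, exists w, forall y, D (s z) g (u y) -> y < w.
  move=> z; apply: (omega1_bounded om1 (S := [set y | D (s z) g (u y)])).
  have /countable_injP[f finj] := D_countable (s z) g.
  apply/countable_injP; exists (f \o u) => y y'; rewrite !inE => yD yD' E.
  by apply/u_inj/finj; rewrite ?inE.
have [y xy Fy] := omega1_closure_point om1 F x; exists y => // z /hull_finitary[r rP rz].
have /choice[k kP] : forall a, exists t, a \in r -> a <> g -> u t = a /\ t < y.
  move=> a; have [[ar ag]|n] := pselect (a \in r /\ a <> g); last first.
    by exists x => ar ag; case: n.
  by case: (rP a ar) => // -[t ty ta]; exists t.
pose k' a := if a == g then x else k a.
have [|w wy wP] := seq_strict_bound (h := k') (s := r) xy.
  by move=> a ar; rewrite /k'; case: eqP => // ag; case: (kP a ar ag).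
suff : D (s w) g (u z) by move=> /FP/lt_trans; apply; exact: Fy.
apply: hull_mono rz => a ar; have [->|/eqP ag] := pselect (a = g); first by left.
right; case: (kP a ar (elimN eqP ag)) => ka _; exists (k a) => //=.
apply: le_lt_trans (sP w); apply: le_trans (wP a ar).
by rewrite /k' (negbTE ag).
Qed.

(** Take for [rho a g] a good [x] with [a] in [D x g]. If [rho _ g] were at most
    [x] on arbitrary finite subsets of an uncountable [A], for suitable [g],
    then every finite subset of [A] would lie in some [D y g] with [y <= x]
    good. The subalgebra generated by aleph_1 elements of [A] would then have
    only a countable part of the range of [u], against the assumption. *)
Lemma algebra_unbounded_function :
  (forall Y, closed_under G Y -> ~ countable Y -> Y #<= [set: W1] ->
     ~ countable (u @^-1` Y)) ->
  exists rho, unbounded_function rho.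
Proof.
move=> noY.
have /choice[r rP] : forall p : W2 * W2, exists x, p.1 < p.2 -> good x p.2 /\ D x p.2 p.1.
  move=> [a g] /=; have [ag|/negP nag] := boolP (a < g); last first.
    by have [x0 _] := omega1_inhabited om1; exists x0.
  have [i [x ix]] := G_enum ag; have [y xy yg] := good_exists x g.
  exists y => _; split=> //; rewrite -ix; apply: hull_closed => b.
  rewrite !inE => /orP[/eqP->|/eqP->]; apply: subset_hull; [by left|right].
  by exists x.
pose rho a g := r (a, g).
have rhoP a g : a < g -> good (rho a g) g /\ D (rho a g) g a by exact: (rP (a, g)).
exists rho; split=> [g x|A x An].
  apply: subset_countable (D_countable x g) => a [/= ag ax].
  by have [_] := rhoP a g ag; exact: D_mono.
apply: contrapT => nF.
have bF (F : seq W2) : (forall a, a \in F -> A a) ->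
    exists2 g, (forall a, a \in F -> a < g) & forall a, a \in F -> rho a g <= x.
  move=> FA; apply: contrapT => ng; apply: nF; exists F => // g Fg.
  apply: contrapT => na; apply: ng; exists g => // a aF; rewrite leNgt.
  by apply/negP => xa; apply: na; exists a.
have [f finj fA] := omega1_embeds om1 An.
have [x0 _] := omega1_inhabited om1.
pose Y := hull G (range f).
apply: (noY Y (@hull_closed _ _ _ _)).
- move=> Yc; apply: (omega1_uncountable om1).
  by apply: (inj_countable (f := f) finj) Yc => i; apply: subset_hull; exists i.
- have /choice[k kP] : forall y, exists i, Y y -> hull G (f @` [set j | j <= i]) y.
    move=> y; have [/hull_finitary[s sf sy]|nY] := pselect (Y y); last by exists x0.
    have /choice[h hP] : forall a, exists i, a \in s -> f i = a.
      move=> a; have [as_|n] := boolP (a \in s); last by exists x0.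
      by have [i _ ia] := sf a as_; exists i.
    have [b bP] := omega1_bounded om1
      (finite_set_countable (finite_image h (finite_seq s))).
    exists b => _; apply: hull_mono sy => a as_; exists (h a); last exact: hP.
    by apply/ltW/bP; exists a.
  apply: (omega1_rank_card om1 (k := k)) => i.
  apply: (@subset_countable _ _ (hull G (f @` [set j | j <= i]))).
    by move=> y [/kP + <-].
  exact/hull_countable/image_countable/(omega1_le_countable om1).
apply: subset_countable (omega1_lt_countable om1 x) => z /= /hull_finitary[s sf sz].
have [g sg sx] := bF (f x0 :: s) (fun a => ltac:(
  by rewrite inE => /predU1P[->|/sf[i _ <-]]; exact: fA)).
have [//|a as_ aP] := seq_maximum (rho ^~ g) (s := f x0 :: s).
have [ga _] := rhoP a g (sg a as_).
apply: lt_le_trans (sx a as_); apply: ga.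
apply: (hull_min _ _ sz); first exact: hull_closed.
move=> b bs; have bs' : b \in f x0 :: s by rewrite inE [X in _ || X]bs orbT.
have [_] := rhoP b g (sg b bs'); apply: D_mono; exact: aP.
Qed.

End Algebra.

(** A structure refuting Chang's conjecture is carried over to omega_2, and its
    Skolem functions are joined by enumerations of the initial segments of
    omega_2 along the distinguished subset, and by infinitely many constants of
    that subset, which make its trace on any subalgebra infinite. *)
Lemma not_chang_transfer_unbounded_function :
  ~ chang_transfer W2 W1 W1 nat -> exists rho, unbounded_function rho.
Proof.
move=> nchang.
have [S [U [Sc [U1 [M [MW2 [MU noB]]]]]]] : exists (S : language) (U : rsym S),
    countable_language S /\ rarity U = 1 /\ exists M : structure S,
    [set: M] #= [set: W2] /\ upred M U #= [set: W1] /\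
    forall (B : set M) (clB : closed_under_functions B), elementary clB ->
    [set: substructure clB] #= [set: W1] ->
    ~ (upred (substructure clB) U #= [set: nat]).
  apply: contrapT => H; apply: nchang => S U Sc U1 M MW2 MU.
  apply: contrapT => nB; apply: H; exists S, U; do !split=> //; exists M.
  by do !split=> //; move=> B clB el BW1 BU; apply: nB; exists B, clB.
have [x0 _] := omega1_inhabited om1.
have [f0 _ _] := omega1_embeds om1 (omega2_uncountable om1 om2).
have [phi [_ phi_inj phi_surj]] := card_eq_set_bij (f0 x0) MW2.
have {}phi_inj : injective phi by move=> a b; apply: phi_inj; rewrite inE.
have /choice[psi psiK] : forall a, exists m, phi m = a.
  by move=> a; have [m _ ma] := phi_surj a I; exists m.
have phiK m : psi (phi m) = m by apply: phi_inj; rewrite psiK.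
have [q [_ q_inj q_surj]] := card_eq_set_bij x0 MU.
have /choice[u' u'P] : forall i, exists m, upred M U m /\ q m = i.
  by move=> i; have [m Um mi] := q_surj i I; exists m.
have u'_inj : injective u'.
  by move=> i j ij; rewrite -(u'P i).2 -(u'P j).2 ij.
pose u i := phi (u' i).
have u_inj : injective u by move=> i j /phi_inj/u'_inj.
have [J [G Jc GP]] := skolem_functions (u' x0) Sc.
have /choice[e eP] : forall g : W2, exists e : W2 -> W1,
    {in [set a | a < g] &, injective e}.
  move=> g; have /(card_le_inj x0)[e _ einj] := omega2_lt_card om2 g.
  by exists e.
have /choice[w wP] : forall p : W2 * W2, exists a,
    forall b, b < p.1 -> u (e p.1 b) = p.2 -> b = a.
  move=> [g y] /=.
  have [[a [ag ay]]|n] := pselect (exists a, a < g /\ u (e g a) = y).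
    exists a => b bg by_; apply: (eP g); rewrite ?inE //.
    by apply: u_inj; rewrite by_.
  by exists g => b bg by_; case: n; exists b.
have [j j_inj _] := omega1_sequence om1 x0.
pose H (k : J + unit + nat) (s : seq W2) : W2 := match k with
  | inl (inl i) => phi (G i (map psi s))
  | inl (inr _) => w (nth (u x0) s 0, nth (u x0) s 1)
  | inr n => u (j n)
  end.
apply: (@algebra_unbounded_function _ H u _ u_inj) => [|a g ag|Y Ycl Yn YW1 Uc].
- have /countable_injP[cj cjinj] := Jc.
  apply/countable_injP; exists (fun k => pickle (match k with
    | inl (inl i) => inl (inl (cj i)) | inl (inr _) => inl (inr tt)
    | inr n => inr n end : nat + unit + nat)).
  move=> [[i|[]]|n] [[i'|[]]|n'] _ _ /(pcan_inj pickleK) // [].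
    by move=> /cjinj ->; rewrite ?inE.
  by move=> ->.
- exists (inl (inr tt)), (e g a) => /=.
  by rewrite -(wP (g, u (e g a)) a).
have [|clB el] := GP (psi @` Y).
  move=> k s sY; exists (H (inl (inl k)) (map phi s)).
    apply: Ycl => a /(nthP (u x0))[n]; rewrite size_map => ns <-.
    by rewrite (nth_map (u' x0)) //; have [b Yb <-] := sY n ns; rewrite psiK.
  rewrite /H /= phiK -map_comp (_ : psi \o phi = id) ?map_id //.
  exact/funext.
have psi_inj : injective psi by move=> a b ab; rewrite -(psiK a) ab psiK.
have BY : psi @` Y #= Y by apply: inj_card_eq => a b _ _; exact: psi_inj.
apply: (noB (psi @` Y) clB el).
  apply: card_eq_trans (card_setT _) _; apply: card_eq_trans BY _.
  rewrite card_eq_le YW1 /=.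
  have [f finj fY] := omega1_embeds om1 Yn.
  apply: (@card_le_trans _ _ _ (range f)); last first.
    by apply: subset_card_le => _ [i _ <-].
  by rewrite (card_le_eqr (inj_card_eq _)) // => a b _ _; exact: finj.
apply: eq_card_nat.
  have /countable_injP[h hinj] := Uc.
  apply/countable_injP; exists (fun m => h (q (sval m))) => m n; rewrite !inE.
  move=> Um Un mn; apply: val_inj; apply: (q_inj); rewrite ?inE //.
  have qY (m' : substructure clB) : upred M U (sval m') -> q (sval m') \in u @^-1` Y.
    move=> Um'; rewrite inE /= /u.
    have -> : u' (q (sval m')) = sval m'.
      by apply: q_inj; rewrite ?inE //; case: (u'P (q (sval m'))).
    have := svalP m'; rewrite inE => -[a Ya <-].
    by rewrite psiK.
  by apply: hinj => //; exact: qY.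
apply/infiniteP.
have jB n : u' (j n) \in psi @` Y.
  rewrite inE; exists (u (j n)); last by rewrite phiK.
  exact: (Ycl (inr n) [::]).
pose f n : substructure clB := exist _ (u' (j n)) (jB n).
have finj : injective f by move=> m n [/u'_inj/j_inj].
apply: (@card_le_trans _ _ _ (range f)).
  by rewrite (card_le_eqr (inj_card_eq _)) // => a b _ _; exact: finj.
by apply: subset_card_le => _ [n _ <-]; case: (u'P (j n)).
Qed.

End UnboundedFunction.

(** * Cylinders and first differences *)

Lemma exists_first_difference (x y : nat -> bool) : x <> y ->
  exists2 n, x n <> y n & forall m, (m < n)%N -> x m = y m.
Proof.
move=> xy; have [n xyn] : exists n, x n != y n.
  apply: contrapT => /forallNP H; apply: xy; apply/funext => n.
  by apply/eqP; have /negP := H n; rewrite negbK.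
have [m /eqP xym mle] := ex_minnP (ex_intro (fun n => x n != y n) n xyn).
exists m => // k km; apply/eqP; apply: contraLR km => /mle.
by rewrite -leqNgt.
Qed.

Lemma first_difference_function :
  exists delta : (nat -> bool) -> (nat -> bool) -> nat,
    forall x y n, x n <> y n -> (forall m, (m < n)%N -> x m = y m) ->
      delta x y = n /\ delta y x = n.
Proof.
have /choice[f fP] : forall p : (nat -> bool) * (nat -> bool), exists k,
    forall n, p.1 n <> p.2 n -> (forall m, (m < n)%N -> p.1 m = p.2 m) -> k = n.
  move=> [x y] /=; have [<-|/exists_first_difference[k xyk kP]] := pselect (x = y).
    by exists 0%N.
  exists k => n xyn nP; case: (ltngtP k n) => // [/nP|/kP] //.
exists (fun x y => f (x, y)) => x y n xyn nP; split; apply: fP => //= [/esym//|m mn].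
by rewrite nP.
Qed.

Definition cylinder (s : seq bool) : set (nat -> bool) :=
  [set x | forall m, (m < size s)%N -> x m = nth false s m].

(** The cylinder of the sequences whose first difference with [x] is at [n]. *)
Definition branch_off (x : nat -> bool) n := rcons (mkseq x n) (~~ x n).

Lemma cylinder_branch_off (x y : nat -> bool) n :
  cylinder (branch_off x n) y <->
  x n <> y n /\ forall m, (m < n)%N -> x m = y m.
Proof.
rewrite /cylinder /branch_off /= size_rcons size_mkseq; split=> [yP|[xyn xyP] m].
  split=> [|m mn].
    by rewrite (yP n (leqnn _)) nth_rcons size_mkseq ltnn eqxx; case: (x n).
  by rewrite (yP m (ltnW mn)) nth_rcons size_mkseq mn nth_mkseq.
rewrite ltnS leq_eqVlt nth_rcons size_mkseq => /predU1P[->|mn].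
  by rewrite ltnn eqxx; case: (x n) (y n) xyn => -[].
by rewrite mn nth_mkseq // xyP.
Qed.

Section Coloring.
Context (d1 d2 : Order.disp_t) (W1 : orderType d1) (W2 : orderType d2).
Hypothesis om1 : succ_initial_ordinal nat W1.

(** For disjoint sets A and B, a triple that starts in A and ends in B belongs
    neither to [A]^3 nor to [B]^3. The third hypothesis is how the equality of
    the suprema enters: B is cofinal above A. *)
Definition hits_mixed_triples (c : W2 -> W2 -> W2 -> W1) :=
  forall a b : W1 -> W2,
    {homo a : i j / i < j} -> {homo b : i j / i < j} ->
    (forall i, exists j, a i < b j) ->
  forall tau, exists x y z, [/\ x < y, y < z & c x y z = tau] /\
    [/\ range a x, (range a `|` range b)%classic y & range b z].

Lemma increasing_injective (f : W1 -> W2) :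
  {homo f : i j / i < j} -> injective f.
Proof.
move=> fm i j ij; case: (ltgtP i j) => // /fm; by rewrite ij ltxx.
Qed.

Lemma injective_image_uncountable (f : W1 -> W2) (S : set W1) :
  injective f -> (forall x, exists2 y, S y & x < y) -> ~ countable (f @` S).
Proof.
move=> finj Su; have /eq_countable -> : f @` S #= S.
  by apply: inj_card_eq => i j _ _; exact: finj.
exact: (omega1_unbounded_uncountable om1).
Qed.

Lemma finite_image_bounded (f : W1 -> W2) (S : set W1) (F : seq W2) :
  (forall x, x \in F -> (f @` S) x) ->
  exists t, forall x, x \in F -> exists k, [/\ k < t, S k & f k = x].
Proof.
move=> FS; have [x0 _] := omega1_inhabited om1.
have /choice[k kP] : forall x, exists k, x \in F -> S k /\ f k = x.
  move=> x; have [xF|nx] := boolP (x \in F); last by exists x0.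
  by have [k Sk kx] := FS x xF; exists k.
have [t tP] := omega1_bounded om1
  (finite_set_countable (finite_image k (finite_seq F))).
exists t => x xF; exists (k x); have [Sk kx] := kP x xF; split=> //.
by apply: tP; exists x.
Qed.

(** For all [j] of large rank, [y j] is a limit of the [y k] of arbitrarily
    large rank, and these branch off from [y j] at infinitely many levels: as
    there are only countably many cylinders, those on which the rank is bounded
    have a common bound. *)
Lemma unbounded_branch_off (D : set W1) (R : W1 -> W1) (y : W1 -> nat -> bool) :
  {in D &, injective y} ->
  exists x0, forall j n1, D j -> x0 <= R j -> exists2 n, (n1 <= n)%N &
    forall x, exists k, [/\ D k, cylinder (branch_off (y j) n) (y k) & x < R k].
Proof.
move=> yinj.
pose unb s := forall x, exists k, [/\ D k, cylinder s (y k) & x < R k].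
have /choice[b bP] : forall s, exists x, ~ unb s ->
    forall k, D k -> cylinder s (y k) -> R k <= x.
  move=> s; have [us|/existsNP[x nx]] := pselect (unb s).
    by have [x _] := omega1_inhabited om1; exists x.
  exists x => _ k Dk sk; rewrite leNgt; apply/negP => xk.
  by apply: nx; exists k.
have [x0 x0P] := omega1_bounded om1 (range_countable b).
have bx s : b s < x0 by apply: x0P; exists s.
exists x0 => j n1 Dj x0j; apply: contrapT => nn.
have : unb (mkseq (y j) n1).
  apply: contrapT => /bP /(_ j Dj) jb.
  suff /jb/le_lt_trans/(_ (bx _)) : cylinder (mkseq (y j) n1) (y j).
    by rewrite ltNge x0j.
  by move=> m; rewrite size_mkseq => mn; rewrite nth_mkseq.
move=> /(_ (Order.max x0 (R j)))[k [Dk kn1]]; rewrite gt_max => /andP[x0k jk].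
have [n jkn nP] : exists2 n, y j n <> y k n & forall m, (m < n)%N -> y j m = y k m.
  apply: exists_first_difference => E; have := yinj _ _ _ _ E.
  by rewrite !inE => /(_ Dj Dk) kj; rewrite kj ltxx in jk.
have n1n : (n1 <= n)%N.
  rewrite leqNgt; apply/negP => nn1; apply: jkn.
  by rewrite kn1 ?size_mkseq // nth_mkseq.
apply: nn; exists n => //; apply: contrapT => /bP /(_ k Dk).
rewrite cylinder_branch_off => /(_ (conj jkn nP)) kb.
by have := lt_trans (le_lt_trans kb (bx _)) x0k; rewrite ltxx.
Qed.

(** * The coloring when there are many reals *)

Lemma enumerated_below_bounded (e : W1 -> nat) (u y z0 : W1) n :
  {in [set x | x <= u] &, injective e} -> y <= u -> z0 < y ->
  exists2 x, x < y & forall z, z < y -> (e z <= n)%N -> z <= x.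
Proof.
move=> einj yu z0y.
suff [x xy xP] : exists2 x, x < y & forall z, z < y -> (e z < n.+1)%N -> z <= x.
  by exists x.
elim: n.+1 => [|m [x xy IH]]; first by exists z0.
have [[w [wy wm]]|nw] := pselect (exists w, w < y /\ e w = m); last first.
  exists x => // z zy; rewrite ltnS leq_eqVlt => /predU1P[zm|]; last exact: IH.
  by case: nw; exists z.
exists (Order.max x w); first by rewrite gt_max xy wy.
move=> z zy; rewrite le_max ltnS leq_eqVlt => /predU1P[zm|zm].
  suff -> : z = w by rewrite lexx orbT.
  by apply: einj; rewrite ?inE /= ?(le_trans (ltW _) yu) // zm wm.
by rewrite (IH z zy zm).
Qed.

(** The case in which omega_2 embeds into the reals. It is enough to recover
    from some triple a closure point [y] of a function that depends on A and B,
    since any color is the value of [p] at such a point.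

    If [e u] maps the ordinals up to [u] injectively to integers, the finite set
    of the [z <= u] with [e u z <= n] contains any given [y <= u] once [n] is
    large, and [y] is then its first element above any [x < y] close enough to
    [y]. So [y] is recovered from [u], [n] and [x]. Here [u] and [x] are values
    of [rho] above and below [y], and [n] is the first difference of two of the
    reals given by the triple; which two is decided by which are closest. Both
    [n] and [x] can be made as large as needed independently of each other,
    because a real with index above [y] is a limit of reals with indices below
    [y], in each of the countably many cylinders that come into question. *)
Lemma many_reals_coloring (r : W2 -> nat -> bool) (rho : W2 -> W2 -> W1) :
  injective r -> unbounded_function rho ->
  exists c : W2 -> W2 -> W2 -> W1, hits_mixed_triples c.
Proof.
move=> rinj [_ rho_unb].
have [p pP] := omega1_stationary_coloring om1.
have [delta deltaP] := first_difference_function.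
have /choice[e eP] : forall u, exists e : W1 -> nat,
    {in [set x | x <= u] &, injective e}.
  by move=> u; apply/countable_injP/(omega1_le_countable om1).
have /choice[br brP] : forall q : nat * W1 * W1, exists w, forall y,
    q.2 <= y -> (e q.1.2 y <= q.1.1)%N ->
    (forall z, q.2 <= z -> z < y -> (q.1.1 < e q.1.2 z)%N) -> w = y.
  move=> [[n u] x] /=.
  have [[w [xw wn wP]]|nw] := pselect (exists w, [/\ x <= w, (e u w <= n)%N &
      forall z, x <= z -> z < w -> (n < e u z)%N]); last first.
    by exists x => y xy yn yP; case: nw; exists y.
  exists w => y xy yn yP; case: (ltgtP w y) => // [wy|yw].
    by have := yP w xw wy; rewrite ltnNge wn.
  by have := wP y xy yw; rewrite ltnNge yn.
have bracket u y z0 n : y <= u -> z0 < y -> (e u y <= n)%N ->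
    exists2 x1, x1 < y & forall x, x1 < x -> x < y -> br (n, u, x) = y.
  move=> yu z0y yn; have [x1 x1y x1P] := enumerated_below_bounded n (@eP u) yu z0y.
  exists x1 => // x x1x xy; apply: brP => //=; first exact: ltW.
  move=> z xz zy; rewrite ltnNge; apply/negP => /(x1P z zy).
  by rewrite leNgt (lt_le_trans x1x xz).
exists (fun x y z => p (if (delta (r x) (r y) < delta (r y) (r z))%N
   then br (delta (r y) (r z), rho x z, rho x y)
   else br (delta (r x) (r y), rho y z, rho x z))).
move=> a b amono bmono ab tau.
have ainj := increasing_injective amono.
have binj := increasing_injective bmono.
have [[i0 i0P]|bounded] := pselect (exists i, forall x, exists j,
    a i < b j /\ x < rho (a i) (b j)).
(* The first element [a i0] is fixed, and a pair from B with close reals is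
   found: [j1] is above the closure point [y], and [j2] below. *)
- pose D := [set j | a i0 < b j]; pose R j := rho (a i0) (b j).
  have rbinj : {in D &, injective (r \o b)} by move=> j k _ _ /rinj/binj.
  have [x0 x0P] := unbounded_branch_off R rbinj.
  have /choice[J JP] : forall q : seq bool * W1, exists k,
      (forall x, exists k, [/\ D k, cylinder q.1 (r (b k)) & x < R k]) ->
      [/\ D k, cylinder q.1 (r (b k)) & q.2 < R k].
    move=> [s x] /=; have [H|] := pselect (forall x, exists k,
        [/\ D k, cylinder s (r (b k)) & x < R k]); last by exists x.
    by have [k kP] := H x; exists k.
  have /choice[F FP] : forall z, exists w, R z < w /\ forall s, J (s, z) < w.
    move=> z; have [w wP] := omega1_bounded om1 (range_countable
      (fun o => if o is Some s then J (s, z) else R z)).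
    by exists w; split=> [|s]; apply: wP; [exists None|exists (Some s)].
  (* [y] is to be recovered by [br] from a triple *)
  have [y [x0y Fy <-]] := pP tau F x0.
  have [j1 [Dj1 yj1]] := i0P y.
  have yj : y <= j1.
    by rewrite leNgt; apply/negP => /Fy/(lt_trans (FP j1).1); rewrite ltNge (ltW yj1).
  have i0j1 : a i0 <> b j1 by move=> E; rewrite E ltxx in Dj1.
  have [m m1 m2] := exists_first_difference (fun E => i0j1 (rinj _ _ E)).
  have [n nP nunb] := x0P j1 (maxn (e (R j1) y) m.+1) Dj1
    (ltW (lt_trans x0y yj1)).
  move: nP; rewrite geq_max => /andP[yn mn].
  have [x1 x1y x1P] := bracket _ _ _ n (ltW yj1) x0y yn.
  have [Dj2 /cylinder_branch_off[n1 n2] xj2] := JP (branch_off (r (b j1)) n, x1) nunb.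
  set j2 := J _ in Dj2 n1 n2 xj2.
  have j2y : j2 < y by apply: lt_trans (Fy x1 x1y); exact: (FP x1).2.
  have Rj2 : R j2 < y by apply: lt_trans (Fy _ j2y); exact: (FP j2).1.
  exists (a i0), (b j2), (b j1); split; last by split; [exists i0|right; exists j2|exists j1].
  split=> //; first exact/bmono/(lt_le_trans j2y).
  rewrite (deltaP _ _ _ n1 n2).2.
  have [|k km|-> _] := deltaP (r (a i0)) (r (b j2)) m.
  + by rewrite -n2.
  + by rewrite -n2 ?m2 //; exact: ltn_trans mn.
  by rewrite mn x1P.
(* All [rho (a i) _] are bounded on B, so they stay below [y] for [i < y], and
   a pair from A with close reals is found: [i] is above [y], and [k] below. *)
- have /choice[H HP] : forall i, exists x, forall j, a i < b j -> rho (a i) (b j) <= x.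
    move=> i; apply: contrapT => nx; apply: bounded; exists i => x.
    apply: contrapT => nj; apply: nx; exists x => j ij; rewrite leNgt.
    by apply/negP => xij; apply: nj; exists j.
  have rainj : {in [set: W1] &, injective (r \o a)} by move=> i j _ _ /rinj/ainj.
  have [x0 x0P] := unbounded_branch_off id rainj.
  (* one [k] bounded in terms of the cylinder and of [x] works for all [g] *)
  have /choice[th thP] : forall q : seq bool * W1, exists t,
      (forall x, exists k, [/\ [set: W1] k, cylinder q.1 (r (a k)) & x < k]) ->
      forall g, (forall k, k < t -> a k < g) ->
      exists k, [/\ k < t, cylinder q.1 (r (a k)) & q.2 < rho (a k) g].
    move=> [s x] /=; have [sunb|] := pselect (forall x, exists k,
        [/\ [set: W1] k, cylinder s (r (a k)) & x < k]); last by exists x.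
    have [|G GA GP] := rho_unb (a @` [set k | cylinder s (r (a k))]) x.
      apply: injective_image_uncountable => // z.
      by have [k [_ ks zk]] := sunb z; exists k.
    have [t tP] := finite_image_bounded GA; exists t => _ g gP.
    have [|al /tP[k [kt ks <-]] xal] := GP g; last by exists k.
    by move=> al /tP[k [kt _ <-]]; exact: gP.
  have /choice[F FP] : forall z, exists w, H z < w /\ forall s, th (s, z) < w.
    move=> z; have [w wP] := omega1_bounded om1 (range_countable
      (fun o => if o is Some s then th (s, z) else H z)).
    by exists w; split=> [|s]; apply: wP; [exists None|exists (Some s)].
  have [y [x0y Fy <-]] := pP tau F x0.
  have [i [j [ij yij]]] : exists i j, a i < b j /\ y < rho (a i) (b j).
    have [|G GA GP] := rho_unb (range a) y.
      apply: injective_image_uncountable => // z.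
      by have [k zk _] := omega1_closure_point om1 id z; exists k.
    have [t tP] := finite_image_bounded GA; have [j tj] := ab t.
    have [|al alG yal] := GP (b j).
      by move=> al /tP[k [kt _ <-]]; apply: lt_trans tj; exact: amono.
    have [k [kt _ kal]] := tP al alG.
    by exists k, j; rewrite kal; split=> //; apply: lt_trans tj; rewrite -kal; exact: amono.
  have yi : y <= i.
    rewrite leNgt; apply/negP => /Fy; have := HP i j ij.
    move=> /(lt_le_trans yij)/lt_trans/(_ (FP i).1)/lt_trans h /h; by rewrite ltxx.
  have aij : a i <> b j by move=> E; rewrite E ltxx in ij.
  have [m m1 m2] := exists_first_difference (fun E => aij (rinj _ _ E)).
  have [n nP nunb] := x0P i (maxn (e (rho (a i) (b j)) y) m.+1) I (ltW (lt_le_trans x0y yi)).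
  move: nP; rewrite geq_max => /andP[yn mn].
  have [x1 x1y x1P] := bracket _ _ _ n (ltW yij) x0y yn.
  have thy : th (branch_off (r (a i)) n, x1) < y.
    by apply: lt_trans (Fy x1 x1y); exact: (FP x1).2.
  have [|k [kt /cylinder_branch_off[n1 n2] xk]] :=
      thP (branch_off (r (a i)) n, x1) nunb (b j).
    by move=> k kt; apply: lt_trans ij; apply: amono; apply: lt_le_trans yi; exact: lt_trans thy.
  have ky : k < y by exact: lt_trans thy.
  have aki : a k < a i by exact/amono/(lt_le_trans ky).
  exists (a k), (a i), (b j); split; last by split; [exists k|left; exists i|exists j].
  split=> //; rewrite (deltaP _ _ _ n1 n2).2 (deltaP _ _ _ m1 m2).1.
  rewrite ltnNge (ltnW mn) /= x1P //.
  apply: le_lt_trans (HP k j (lt_trans aki ij)) _.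
  by apply: lt_trans (Fy k ky); exact: (FP k).1.
Qed.

End Coloring.

(** * The coloring when there are few reals *)

Lemma nat_well_order : well_order (<=%O : rel nat).
Proof.
apply: antisymmetric_well_order => [|A [x xA]]; first exact: le_anti.
have [m mA mle] := ex_minnP (ex_intro (fun n => n \in A) x xA).
by exists m; split=> // y yA; rewrite leEnat; exact: mle.
Qed.

(** Countably many requirements to take a given value on a given infinite set
    are compatible: they can be met at distinct points. *)
Lemma meet_countably_many (T U : Type) (u0 : U) (Q : set (set T * U)) :
  countable Q -> (forall q, Q q -> infinite_set q.1) ->
  exists c : T -> U, forall q, Q q -> exists2 x, q.1 x & c x = q.2.
Proof.
move=> Qc Qinf; have [Q0|] := pselect (Q !=set0); last first.
  by move=> Q0; exists (fun=> u0) => q Qq; case: Q0; exists q.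
have [[q0 Qq0] [d dQ]] := (Q0, countable_enumeration Qc Q0).
have dinf n : infinite_set (d n).1 by apply: Qinf; rewrite -dQ; exists n.
have [t0 _] := infinite_setN0 (Qinf q0 Qq0).
have [|f fP] := transfinite_choice nat_well_order t0
    (Q := fun n R t => (d n).1 t /\ ~ R t).
  move=> n f; apply/infinite_setN0/infinite_setD => //.
  apply: finite_image; apply: sub_finite_set (finite_II n) => k /=.
  by rewrite ltEnat.
have finj : injective f.
  move=> m n mn; case: (ltgtP m n) => // [mn'|nm'].
    by case: (fP n) => _ []; exists m.
  by case: (fP m) => _ []; exists n.
have /choice[c cP] : forall x, exists u, forall n, f n = x -> u = (d n).2.
  move=> x; have [[n nx]|n] := pselect (exists n, f n = x).
    by exists (d n).2 => m mx; congr (d _).2; apply: finj; rewrite nx.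
  by exists u0 => m mx; case: n; exists m.
exists c => q; rewrite -dQ => -[n _ <-]; exists (f n); last exact: cP.
by case: (fP n).
Qed.

Section FewReals.
Context (d1 d2 : Order.disp_t) (W1 : orderType d1) (W2 : orderType d2).
Hypothesis om1 : succ_initial_ordinal nat W1.
Hypothesis om2 : succ_initial_ordinal W1 W2.
Context (ka : (nat -> bool) -> W1).
Hypothesis ka_inj : injective ka.

Lemma countable_enumerations : exists en : set W2 -> nat -> W2,
  forall Z, countable Z -> Z !=set0 -> range (en Z) = Z.
Proof.
suff /choice[en enP] : forall Z : set W2, exists f : nat -> W2,
    countable Z -> Z !=set0 -> range f = Z by exists en.
move=> Z; have [[Zc Z0]|n] := pselect (countable Z /\ Z !=set0).
  by have [f fZ] := countable_enumeration Zc Z0; exists f.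
have [x0 _] := omega1_inhabited om1.
have [f0 _ _] := omega1_embeds om1 (omega2_uncountable om1 om2).
by exists (fun=> f0 x0) => Zc Z0; case: n.
Qed.

(** The subsets of a countable set correspond to reals, hence to countable
    ordinals; the indexing depends on the countable set alone. *)
Lemma subset_indexing : exists P : set W2 -> W1 -> set W2, forall Z X,
  countable Z -> Z !=set0 -> X `<=` Z -> exists h, P Z h = X.
Proof.
have /choice[q qP] : forall h, exists y, forall x, ka x = h -> y = x.
  move=> h; have [[y yh]|n] := pselect (exists y, ka y = h).
    by exists y => x xh; apply: ka_inj; rewrite yh.
  by exists (fun=> true) => x xh; case: n; exists x.
have [en enP] := countable_enumerations.
exists (fun Z h => en Z @` [set n | q h n]) => Z X Zc Z0 XZ.
exists (ka (fun n => `[< X (en Z n) >])); rewrite (qP _ _ erefl).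
apply/seteqP; split=> [_ [n /asboolP Xn <-]//|x Xx].
have := XZ x Xx; rewrite -{1}(enP Z Zc Z0) => -[n _ nx].
by exists n => //; apply/asboolP; rewrite nx.
Qed.

(** A countable set of ordinals below [b] is given by a sequence of countable
    ordinals, hence by a sequence of reals, hence by one real. *)
Lemma countable_set_code : exists ind : W2 -> set W2 -> W1, forall b Z Z',
  (countable Z /\ Z !=set0 /\ forall x, Z x -> x < b) ->
  (countable Z' /\ Z' !=set0 /\ forall x, Z' x -> x < b) ->
  ind b Z = ind b Z' -> Z = Z'.
Proof.
have [x0 _] := omega1_inhabited om1.
have [r rinj _] := omega1_embeds om1 reals_uncountable.
have /choice[e eP] : forall b : W2, exists e : W2 -> W1,
    {in [set x | x < b] &, injective e}.
  move=> b; have /(card_le_inj x0)[e _ einj] := omega2_lt_card om2 b.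
  by exists e.
have [en enP] := countable_enumerations.
pose code b Z k := if unpickle k is Some (m, n) then
  r (e b (en Z m)) n else false.
exists (fun b Z => ka (code b Z)) => b Z Z' [Zc [Z0 Zb]] [Z'c [Z'0 Z'b]].
move=> /ka_inj E; rewrite -(enP Z) // -(enP Z') //; congr (@image nat W2 setT _).
apply/funext => m; apply: (eP b).
- rewrite inE; apply: Zb; have : range (en Z) (en Z m) by exists m.
  by rewrite enP.
- rewrite inE; apply: Z'b; have : range (en Z') (en Z' m) by exists m.
  by rewrite enP.
apply: rinj; apply/funext => n.
have := congr1 (fun f => f (pickle (m, n))) E.
by rewrite /code pickleK.
Qed.

(** The case in which there are aleph_1 reals only. For [y < z], the values of
    [c _ y z] are chosen so that every color up to a countable ordinal [Phi y z]
    is taken on every infinite set of a countable family [Fam y (Phi y z)]; the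
    families [Fam y v] increase with [v] and exhaust the nonempty countable sets
    bounded below [y]. So it is enough to find an infinite set X of elements of
    A, and [y < z] above X, with [Phi y z] larger than the index of X for [y].

    This is clear if [Phi y] is unbounded on B for some [y] with infinitely many
    elements of A below it. Suppose that [Phi y] is instead bounded on B by
    [h y] for all such [y], and take any X that consists of such elements. Since
    [rho <= Phi], there is a [u] with [rho x z <= u] for all [x] in X and [z] in
    B above X. There is a [y] in B with [u < rho y z] for uncountably many [z]
    in B. For these [z], the set of the [x < y] with [rho x z <= u], which
    contains X, has a code at most [h y]; this is how [Phi] is chosen. So this
    set is the same for uncountably many [z], all in a subset B' of B. Then X
    is definable from it and one countable ordinal, so its index is bounded on
    B', whereas [rho] is not. *)
Lemma few_reals_coloring (rho : W2 -> W2 -> W1) :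
  unbounded_function rho ->
  exists c : W2 -> W2 -> W2 -> W1, hits_mixed_triples c.
Proof.
move=> [rho_countable rho_unb].
have [x0 _] := omega1_inhabited om1.
have [P PP] := subset_indexing.
have [ind indP] := countable_set_code.
pose Zs z u y := [set x | x < y /\ (x < z /\ rho x z <= u)].
have Zs_countable z u y : countable (Zs z u y).
  by apply: subset_countable (rho_countable z u) => x [_].
have /choice[Phi2 Phi2P] : forall p : W2 * W2, exists v, rho p.1 p.2 <= v /\
    forall u, u <= rho p.1 p.2 -> ind p.1 (Zs p.2 u p.1) <= v.
  move=> [y z] /=; have [v vP] := omega1_bounded om1
    (image_countable (fun u => Order.max (rho y z) (ind y (Zs z u y)))
      (omega1_le_countable om1 (rho y z))).
  have vu u : u <= rho y z -> rho y z < v /\ ind y (Zs z u y) < v.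
    move=> uz; apply/andP; rewrite -gt_max; apply: vP; by exists u.
  exists v; split=> [|u /vu[_ /ltW]//].
  by case: (vu (rho y z) (lexx _)) => /ltW.
pose Phi y z := Phi2 (y, z).
have rho_Phi y z : rho y z <= Phi y z by case: (Phi2P (y, z)).
have ind_Phi y z u : u <= rho y z -> ind y (Zs z u y) <= Phi y z.
  by case: (Phi2P (y, z)) => _; exact.
pose Fam y v := [set X | exists u h y', [/\ u <= v, h <= v, y' < y,
  rho y' y <= v & X = P (Zs y u y') h]].
have Fam_le y v w : v <= w -> Fam y v `<=` Fam y w.
  move=> vw X [u [h [y' [uv hv y'y y'v ->]]]]; exists u, h, y'.
  by split=> //; exact: le_trans vw.
have Fam_countable y v : countable (Fam y v).
  have vc := omega1_le_countable om1 v.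
  apply: subset_countable (image_countable
    (fun p : W1 * W1 * W2 => P (Zs y p.1.1 p.2) p.1.2)
    (countableX (countableX vc vc) (rho_countable y v))).
  by move=> X [u [h [y' [uv hv y'y y'v ->]]]]; exists (u, h, y').
have Fam_intro X y y' : countable X -> X !=set0 ->
    (forall x, X x -> x < y') -> y' < y -> exists v, Fam y v X.
  move=> Xc X0 Xy' y'y.
  have [u uP] := omega1_bounded om1 (image_countable (rho ^~ y) Xc).
  have XZ : X `<=` Zs y u y'.
    move=> x Xx; split; first exact: Xy'.
    split; first exact: lt_trans (Xy' x Xx) y'y.
    by apply/ltW/uP; exists x.
  have [x Xx] := X0.
  have [h hX] := PP (Zs y u y') X (Zs_countable _ _ _)
    (ex_intro _ x (XZ x Xx)) XZ.
  exists (Order.max u (Order.max h (rho y' y))), u, h, y'.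
  by rewrite hX !le_max !lexx !orbT.
have /choice[c2 c2P] : forall p : W2 * W2, exists c : W2 -> W1,
    forall X t, Fam p.1 (Phi2 p) X -> infinite_set X -> t <= Phi2 p ->
    exists2 x, X x & c x = t.
  move=> p; have [||c cP] := meet_countably_many x0
      (Q := [set q | [/\ Fam p.1 (Phi2 p) q.1, infinite_set q.1 & q.2 <= Phi2 p]]).
  - apply: subset_countable (countableX (Fam_countable p.1 (Phi2 p))
      (omega1_le_countable om1 (Phi2 p))) => q [Fq _ qP].
    by split.
  - by move=> q [].
  by exists c => X t FX Xinf tP; apply: (cP (X, t)).
exists (fun x y z => c2 (y, z) x) => a b amono bmono ab tau.
have ainj := increasing_injective amono.
have binj := increasing_injective bmono.
have sequence_infinite (f : nat -> W1) : injective f ->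
    infinite_set (range (a \o f)).
  move=> finj; apply/infiniteP.
  by rewrite (card_le_eqr (inj_card_eq _)) // => m n _ _ /ainj/finj.
have b_tail j : ~ countable (b @` [set k | j < k]).
  apply: injective_image_uncountable => // x.
  have [k] := omega1_closure_point om1 id (Order.max j x).
  by rewrite gt_max => /andP[jk xk] _; exists k.
have above B' j : B' `<=` range b -> ~ countable B' -> exists2 z, B' z & b j < z.
  move=> B'b B'n; apply: contrapT => nz; apply: B'n.
  apply: subset_countable (image_countable b (omega1_le_countable om1 j)).
  move=> z B'z; have [k _ kz] := B'b z B'z; exists k => //=.
  by rewrite leNgt; apply/negP => /bmono jk; apply: nz; exists z => //; rewrite -kz.
have [f0 f0inj [i1 f0P]] := omega1_sequence om1 x0.
have [[y [yAB i1y yP]]|bounded] := pselect (exists y,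
    [/\ (range a `|` range b)%classic y, a i1 < y &
      forall x, exists j, y < b j /\ x < Phi y (b j)]).
  (* the first elements of A form a set with some index for [y] *)
  pose X := range (a \o f0).
  have Xi1 x : X x -> x < a i1.
    by move=> [n _ <-]; apply: amono; case/andP: (f0P n).
  have [v vP] := Fam_intro X y (a i1) (range_countable _)
    (ex_intro _ (a (f0 0%N)) (ex_intro2 _ _ 0%N I erefl)) Xi1 i1y.
  have [j [yj]] := yP (Order.max v tau); rewrite gt_max => /andP[vj tj].
  have [x Xx xtau] := c2P (y, b j) X tau (Fam_le _ _ _ (ltW vj) _ vP)
    (sequence_infinite f0 f0inj) (ltW tj).
  exists x, y, (b j); split; first by split=> //; apply: lt_trans i1y; exact: Xi1.
  by split; [case: Xx => n _ <-; exists (f0 n)|exact: yAB|exists j].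
have /choice[h hP] : forall y, exists v, (range a `|` range b)%classic y ->
    a i1 < y -> forall j, y < b j -> Phi y (b j) <= v.
  move=> y; have [[yAB i1y]|n] := pselect
    ((range a `|` range b)%classic y /\ a i1 < y); last first.
    by exists x0 => yAB i1y; case: n.
  have [v vP] : exists v, forall j, y < b j -> Phi y (b j) <= v.
    apply: contrapT => nv; apply: bounded; exists y; split=> // x.
    apply: contrapT => nj; apply: nv; exists x => j yj; rewrite leNgt.
    by apply/negP => xj; apply: nj; exists j.
  by exists v.
have [f1 f1inj [i2 f1P]] := omega1_sequence om1 i1.
pose X := range (a \o f1).
have Xinf : infinite_set X by exact: sequence_infinite.
have Xi2 x : X x -> x < a i2.
  by move=> [n _ <-]; apply: amono; case/andP: (f1P n).
have i12 : i1 < i2 by case/andP: (f1P 0%N); exact: lt_trans.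
have [u uP] := omega1_bounded om1 (range_countable (fun n => h (a (f1 n)))).
have Xu x j : X x -> x < b j -> rho x (b j) <= u.
  move=> [n _ <-] xj; apply: le_trans (rho_Phi _ _) _.
  apply: le_trans (hP (a (f1 n)) _ _ j xj) _; first by left; exists (f1 n).
    by apply: amono; case/andP: (f1P n).
  by apply/ltW/uP; exists n.
have [j2 i2j2] := ab i2.
have [F Fb FP] := rho_unb (b @` [set k | j2 < k]) u (b_tail j2).
have [t tP] := finite_image_bounded om1 Fb.
have [y yF yn] : exists2 y, y \in F &
    ~ countable [set z | range b z /\ (y < z /\ u < rho y z)].
  apply: contrapT => nF; apply: (b_tail t).
  apply: (@subset_countable _ _ (\bigcup_(y in [set` F])
      [set z | range b z /\ (y < z /\ u < rho y z)])).
    move=> _ [k tk <-]; have Fk x : x \in F -> x < b k.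
      by move=> /tP[m [mt _ <-]]; apply: bmono; exact: lt_trans tk.
    have [y yF uy] := FP (b k) Fk; exists y => //; split; first by exists k.
    by split=> //; exact: Fk.
  apply: bigcup_countable; first exact/finite_set_countable/finite_seq.
  by move=> y yF; apply: contrapT => yn; apply: nF; exists y.
have [k1 [_ /= j2k1 k1y]] := tP y yF.
have i2y : a i2 < y by apply: lt_trans i2j2 _; rewrite -k1y; exact: bmono.
have yAB : (range a `|` range b)%classic y by right; exists k1.
have hy j : y < b j -> Phi y (b j) <= h y.
  by apply: hP => //; apply: lt_trans i2y; exact: amono.
(* uncountably many [z] agree on the code of [Zs z u y], hence on that set *)
have [w wn] : exists w, ~ countable [set z | [/\ range b z, y < z, u < rho y z &
    ind y (Zs z u y) = w]].
  apply: contrapT => nw; apply: yn.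
  apply: (@subset_countable _ _ (\bigcup_(w in [set w | w <= h y])
     [set z | [/\ range b z, y < z, u < rho y z & ind y (Zs z u y) = w]])).
    move=> z [[j _ <-] [yj uj]]; exists (ind y (Zs (b j) u y)).
      by apply: le_trans (hy j yj); exact/ind_Phi/ltW.
    by split=> //; exists j.
  apply: bigcup_countable; first exact: (omega1_le_countable om1).
  by move=> w _; apply: contrapT => wn; apply: nw; exists w.
set B' := [set z | _] in wn.
have B'b : B' `<=` range b by move=> z [].
have XZ z : B' z -> X `<=` Zs z u y.
  move=> [[j _ <-] yj _ _] x Xx; have xy := lt_trans (Xi2 x Xx) i2y.
  by split=> //; split; [exact: lt_trans yj|exact/Xu/(lt_trans xy)].
have [z0 B'z0 _] := above B' t B'b wn.
have Znice z : B' z -> countable (Zs z u y) /\ Zs z u y !=set0 /\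
    forall x, Zs z u y x -> x < y.
  move=> B'z; split; first exact: Zs_countable.
  split; last by move=> x [].
  by exists (a (f1 0%N)); apply: (XZ z B'z); exists 0%N.
have ZsE z : B' z -> Zs z u y = Zs z0 u y.
  move=> B'z; apply: indP (Znice z B'z) (Znice z0 B'z0) _.
  by case: B'z => _ _ _ ->; case: B'z0.
have [c0 [Z0 _]] := Znice z0 B'z0.
have [g gX] := PP _ X c0 Z0 (XZ z0 B'z0).
pose v := Order.max (Order.max u g) (Order.max (h y) tau).
have FamX z : B' z -> Fam z v X.
  move=> B'z; exists u, g, y; rewrite (ZsE z B'z) gX /v !le_max !lexx ?orbT.
  split=> //; first by case: B'z.
  by case: B'z => -[j _ <-] yj _ _; rewrite (le_trans (rho_Phi _ _) (hy j yj)) orbT.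
have [F' F'B F'P] := rho_unb B' v wn.
have [t' t'P] := finite_image_bounded om1 (fun x xF => B'b x (F'B x xF)).
have [z1 B'z1 t'z1] := above B' t' B'b wn.
have [|y1 y1F' vy1] := F'P z1.
  by move=> x /t'P[k [kt _ <-]]; apply: lt_trans t'z1; exact: bmono.
have B'y1 := F'B y1 y1F'.
have vPhi : v <= Phi y1 z1 by apply: le_trans (rho_Phi _ _); exact: ltW.
have tauPhi : tau <= Phi y1 z1.
  by apply: le_trans vPhi; rewrite !le_max lexx !orbT.
have [x Xx xtau] := c2P (y1, z1) X tau (Fam_le _ _ _ vPhi _ (FamX y1 B'y1))
  Xinf tauPhi.
exists x, y1, z1; split.
  split=> //.
    by apply: lt_trans (Xi2 x Xx) _; apply: lt_trans i2y _; case: B'y1.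
  have [k [kt _ <-]] := t'P y1 y1F'.
  by apply: lt_trans t'z1; exact: bmono.
split; [by case: Xx => n _ <-; exists (f1 n)|right; exact: B'b|exact: B'b].
Qed.

End FewReals.

(** * The equivalence *)

Lemma unbounded_function_coloring (d1 d2 : Order.disp_t) (W1 : orderType d1)
    (W2 : orderType d2) (rho : W2 -> W2 -> W1) :
  succ_initial_ordinal nat W1 -> succ_initial_ordinal W1 W2 ->
  unbounded_function rho ->
  exists c : W2 -> W2 -> W2 -> W1, hits_mixed_triples c.
Proof.
move=> om1 om2 rhoP; have [x0 _] := omega1_inhabited om1.
have [le|nle] := pselect ([set: nat -> bool] #<= [set: W1]).
  have /(card_le_inj x0)[ka _ kainj] := le.
  have {}kainj : injective ka by move=> x y; apply: kainj; rewrite inE.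
  exact (few_reals_coloring om1 om2 kainj rhoP).
have wo2 : well_order (<=%O : rel W2) by case: om2.
have [|r rP] := transfinite_choice wo2 (fun=> true)
    (Q := fun _ R (t : nat -> bool) => ~ R t).
  move=> x f; apply: contrapT => H; apply: nle.
  apply: card_le_trans (omega2_lt_card om2 x).
  apply: card_le_trans (card_image_le f _).
  apply: subset_card_le => t _; apply: contrapT => ft.
  by apply: H; exists t.
apply: (many_reals_coloring om1 (r := r) _ rhoP) => x y xy.
by case: (ltgtP x y) => // [xy'|yx']; [case: (rP y); exists x|case: (rP x); exists y].
Qed.

Lemma common_supremum_cofinal (d1 d2 : Order.disp_t) (W1 : orderType d1)
    (W2 : orderType d2) (a b : W1 -> W2) (s : W2) :
  succ_initial_ordinal nat W1 -> {homo a : x y / x < y} ->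
  supremums (range a) s -> supremums (range b) s ->
  forall i, exists j, a i < b j.
Proof.
move=> om1 amono [sub _] [_ sle] i; apply: contrapT => nj.
have [k ik _] := omega1_closure_point om1 id i.
have /(le_trans (sub (a k) (ex_intro2 _ _ k I erefl))) : s <= a i.
  by apply: sle => _ [j _ <-]; rewrite leNgt; apply/negP => ij; apply: nj; exists j.
by rewrite leNgt amono.
Qed.

Local Close Scope order_scope.

Theorem theoremC (d1 d2 : Order.disp_t) (W1 : orderType d1) (W2 : orderType d2)
    (W1_omega1 : succ_initial_ordinal nat W1)
    (W2_omega2 : succ_initial_ordinal W1 W2) :
  ~ chang_transfer W2 W1 W1 nat <->
  exists c : triples [set: W2] -> W1,
    forall A B : set W2, A `&` B = set0 ->
      has_order_type W1 A -> has_order_type W1 B ->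
      (exists s : W2, supremums A s /\ supremums B s) ->
    forall tau : W1, exists t : triples [set: W2],
      (triples (A `|` B) `\` (triples A `|` triples B)) (val t) /\ c t = tau.
Proof.
split=> [nchang|[c cP] chang]; last first.
  have [A [B [tau [AB0 A1 B1 ABs ABtau]]]] :=
    chang_transfer_omits_color W1_omega1 W2_omega2 c chang.
  have [t [[tAB _] ct]] := cP A B AB0 A1 B1 ABs tau.
  exact: ABtau tAB ct.
have [rho rhoP] := not_chang_transfer_unbounded_function W1_omega1 W2_omega2 nchang.
have [c cP] := unbounded_function_coloring W1_omega1 W2_omega2 rhoP.
exists (fun t => c (val t).1.1 (val t).1.2 (val t).2).
move=> A B AB0 [a amono aA] [b bmono bB] [s [As Bs]] tau; subst A B.
have [x [y [z [[xy yz cxyz] [ax aby bz]]]]] :=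
  cP a b amono bmono (common_supremum_cofinal W1_omega1 amono As Bs) tau.
have xyz : triples [set: W2] (x, y, z) by [].
exists (SigSub (mem_set xyz)); split=> //.
have AB0' w : range a w -> range b w -> False.
  by move=> aw bw; have : (range a `&` range b) w by []; rewrite AB0.
split; first by split=> //=; [left|right].
by move=> [[_ _ /= az _ _]|[/= bx _ _ _ _]]; [exact: AB0' az bz|exact: AB0' ax bx].
Qed.
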